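(* Let $2 \le p < \infty$ and $s > \frac{p-2}{p-1}$. Let $C \subset \mathbb{R}$ be any closed subset with $\mathcal{H}^s(C) > 0$, and let $F$ be any set of the form $F = [0,1] \setminus \bigcup_{j=1}^\infty I_j$, where the $I_j$ are open intervals satisfying $$\sum_{j=1}^\infty |I_j|^{1-(1-s)(p-1)} < \infty,$$ and such that $\mathcal{H}^1(F) > 0$. Then the set $C \times F \subset \mathbb{R}^2$ is not $p$-removable.
   Context: $\mathcal{H}^s$ denotes the $s$-dimensional Hausdorff measure (so $\mathcal{H}^1$ on $\mathbb{R}$ is Lebesgue measure), and $|I|$ is the length of an interval $I$. For an open set $\Omega \subset \mathbb{R}^2$ and $1 \le p \le \infty$, $W^{1,p}(\Omega)$ consists of those $f \in L^p(\Omega)$ whose weak first order partial derivatives $\partial_i f$ are also in $L^p(\Omega)$. A closed set $E \subset \mathbb{R}^2$ is called $p$-removable (removable for $W^{1,p}$) if it has Lebesgue measure zero and $W^{1,p}(\mathbb{R}^2 \setminus E) = W^{1,p}(\mathbb{R}^2)$ as sets, i.e. every $u \in W^{1,p}(\mathbb{R}^2\setminus E)$, regarded as a function defined almost everywhere on $\mathbb{R}^2$, belongs to $W^{1,p}(\mathbb{R}^2)$. In particular, a set of positive Lebesgue measure is not $p$-removable. *)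

(* Defs.v *)
From mathcomp Require Import all_boot all_order all_algebra.
From mathcomp Require Import all_classical all_reals all_analysis.

Set Implicit Arguments.
Unset Strict Implicit.
Unset Printing Implicit Defensive.

Import Order.TTheory GRing.Theory Num.Theory.
Import numFieldNormedType.Exports.

Local Open Scope classical_set_scope.
Local Open Scope ring_scope.

Section HausdorffMeasure.
Context {R : realType}.
Local Open Scope ereal_scope.

Definition diam (U : set R) : \bar R :=
  ereal_sup [set z | exists x y, [/\ U x, U y & z = `|x - y|%:E]].

(* The empty set contributes 0 (its [diam] is -oo); a nonempty set U
   contributes (diam U)^s, with the convention 0^0 = 1. *)
Definition hausdorff_gauge (s : R) (U : set R) : \bar R :=
  if U == set0 then 0 else diam U `^ s.

Definition hausdorff_content (s delta : R) (A : set R) : \bar R :=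
  ereal_inf [set z | exists U : nat -> set R,
    [/\ A `<=` \bigcup_j U j,
        forall j, diam (U j) <= delta%:E
      & z = \sum_(j <oo) hausdorff_gauge s (U j)]].

(* No normalizing constant, so that s = 1 gives Lebesgue (outer) measure. *)
Definition hausdorff_measure (s : R) (A : set R) : \bar R :=
  ereal_sup [set hausdorff_content s delta A | delta in [set d | (0 < d)%R]].

End HausdorffMeasure.

Section Sobolev.
Context {R : realType}.

Definition lebesgue2 : {measure set (measurableTypeR R * measurableTypeR R) -> \bar R} :=
  (@lebesgue_measure R \x @lebesgue_measure R)%E.

Definition e1 : R * R := (1, 0).
Definition e2 : R * R := (0, 1).

Fixpoint Ck (k : nat) (phi : R * R -> R) : Prop :=
  continuous phi /\
  if k is k'.+1 then
    [/\ forall x, derivable phi x e1, forall x, derivable phi x e2,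
        Ck k' (fun x => 'D_e1 phi x) & Ck k' (fun x => 'D_e2 phi x)]
  else True.

Definition test_function (Omega : set (R * R)) (phi : R * R -> R) : Prop :=
  [/\ forall k, Ck k phi,
      compact (closure [set x | phi x != 0])
    & closure [set x | phi x != 0] `<=` Omega].

(* Elements of L^p are a.e.-classes, each of which has a Borel representative;
   [inLp] is about such representatives ([Lfun] requires measurability for the
   Borel sigma-algebra of the plane).  Only the values on Omega matter, since
   [f \_ Omega] is the extension by zero. *)
Definition inLp (p : \bar R) (Omega : set (R * R)) (f : R * R -> R) : Prop :=
  f \_ Omega \in Lfun lebesgue2 p.

Definition weak_partial (Omega : set (R * R)) (e : R * R) (f g : R * R -> R) :
    Prop :=
  forall phi, test_function Omega phi ->
    (\int[lebesgue2]_(x in Omega) (f x * 'D_e phi x)%:E =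
     - \int[lebesgue2]_(x in Omega) (g x * phi x)%:E)%E.

Definition sobolev1 (p : \bar R) (Omega : set (R * R)) (f : R * R -> R) :
    Prop :=
  inLp p Omega f /\
  forall e, e = e1 \/ e = e2 ->
    exists2 g, inLp p Omega g & weak_partial Omega e f g.

(* Meant for closed E. A function u on ~` E is regarded as an a.e.-defined
   function on the plane through its extension by zero [u \_ (~` E)], which is
   a Borel representative of it because E is a null set. *)
Definition removable (p : \bar R) (E : set (R * R)) : Prop :=
  lebesgue2 E = 0%E /\
  forall u, sobolev1 p (~` E) u -> sobolev1 p setT (u \_ (~` E)).

End Sobolev.

(* Main.v *)
(* Let h(x) be the Hausdorff content H^s_delta of a bounded piece of C to the
   left of x: subadditivity makes h nondecreasing, s-Hoelder and locally constant
   off C, so h plays the role of the distribution function of a Frostman measure.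
   The tent function k = min(h, M - h) has the same properties and compact
   support.  With a = min F, b = max F and d(y) comparable to the distance of y to
   F, the function
     u(x, y) = B(y) * (average of k over [x, x + d(y)]),
   which is B(y) * k(x) for y in F, is C^1 off C x F (B is a smooth bump on
   [a, b]).  Its gradient is controlled by (h(x + d) - h(x)) / d, whose p-th power
   integrates in x to at most a multiple of d^(- (1 - s)(p - 1)) by the Hoelder
   bound, and this power of d is integrable over the gaps of F by the summability
   of the |I_j|^(1 - (1 - s)(p - 1)).  So u is in W^{1,p} off C x F.

   If C x F is not already of positive measure, C is a null set.  Testing a weak
   x-derivative of u on the plane with f(x) chi_n(x) g(y), where the cut-offs
   chi_n vanish near C and tend to 1 off C, shows that it is the classical one,
   which is 0 for y in F.  Then the integral of B(y) g(y) over F times that of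
   k f' over R must be 0, which fails for f increasing on the support of k. *)
Require Import Defs.
From mathcomp Require Import all_boot all_order all_algebra.
From mathcomp Require Import all_classical all_reals all_analysis.
From mathcomp Require Import measurable_realfun ring lra.

Set Implicit Arguments.
Unset Strict Implicit.
Unset Printing Implicit Defensive.

Import Order.TTheory GRing.Theory Num.Theory.
Import numFieldNormedType.Exports.

Local Open Scope classical_set_scope.
Local Open Scope ring_scope.

(** * Measurability and C^1 functions on the plane *)

(** For y in F strictly between a and b, the slice x |-> u(x, y) is a positive multiple of k:
    continuous, locally constant off the null set C, and yet not constant. It is not absolutely
    continuous, and this happens on a set of lines of positive measure, which membership in W^{1,p}
    of the plane forbids. The gaps of F have to smooth this out at finite cost. The condition on s
    says exactly that (1 - s)(p - 1) < 1, which is the threshold for d^(-(1 - s)(p - 1)) to be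
    integrable up to the ends of a gap.

    The content at a fixed scale can replace a Frostman measure because only upper bounds on the
    increments of h are used, never additivity; it is also finite on bounded sets, whereas H^s(C)
    may be infinite. The forward average over [x, x + d(y)] is preferred to a smooth mollifier
    because it needs only an antiderivative of k, and both of its partial derivatives are
    differences of k (or of its averages) over one window, divided by d. *)

(** Each point of A lies in a box with rational corners inside A, and there are countably many of
    these. This links the topology of the plane to the product sigma-algebra. *)
Lemma open_measurable2 (R : realType) (A : set (R * R)) :
  open A -> measurable (A : set (measurableTypeR R * measurableTypeR R)).
Proof.
move=> oA.
pose box (q : (rat * rat) * (rat * rat)) : set (R * R) :=
  `]ratr q.1.1, ratr q.1.2[ `*` `]ratr q.2.1, ratr q.2.2[.
pose F q := if `[< box q `<=` A >] then box q else set0.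
have -> : A = \bigcup_q F q.
  apply/seteqP; split => [[x y] Axy|z [q _]]; last first.
    by rewrite /F; case: asboolP => // + qz; exact.
  have /nbhs_ballP[e /= e0 eA] : nbhs (x, y) A by exact: open_nbhs_nbhs.
  have ratlt (u v : R) : u < v -> exists q : rat, u < ratr q < v.
    by move=> /rat_in_itvoo[q]; rewrite in_itv/= => ?; exists q.
  have [a1 /andP[a11 a12]] := ratlt (x - e) x ltac:(lra).
  have [a2 /andP[a21 a22]] := ratlt x (x + e) ltac:(lra).
  have [b1 /andP[b11 b12]] := ratlt (y - e) y ltac:(lra).
  have [b2 /andP[b21 b22]] := ratlt y (y + e) ltac:(lra).
  exists ((a1, a2), (b1, b2)) => //; rewrite /F asboolT.
    by split; rewrite /= in_itv/=; apply/andP; split.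
  move=> [x' y'] [/=]; rewrite !in_itv/= => /andP[? ?] /andP[? ?].
  by apply: eA; split; rewrite /ball/= ltr_norml; apply/andP; split; lra.
apply: countable_bigcupT_measurable => // q; rewrite /F; case: asboolP => // _.
by apply: measurableX; exact: measurable_itv.
Qed.

Lemma open_continuous_measurable_fun2 (R : realType) (D : set (R * R))
    (f : R * R -> R) : open D -> {in D, continuous f} ->
  measurable_fun (D : set (measurableTypeR R * measurableTypeR R)) f.
Proof.
move=> oD cf; apply: (measurability _ (RGenOpens.measurableE R)).
move=> _ [_ [a [b ->] <-]]; apply: open_measurable2.
rewrite openE => z [Dz fz]; rewrite /interior.
apply: filterI; first exact: open_nbhs_nbhs.
apply: (cf z); first exact/mem_set.
by apply: open_nbhs_nbhs; split => //; exact: interval_open.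
Qed.

Lemma continuous_measurable_fun2 (R : realType) (f : R * R -> R) :
  continuous f -> measurable_fun [set: measurableTypeR R * measurableTypeR R] f.
Proof.
by move=> cf; apply: open_continuous_measurable_fun2 => //; exact: openT.
Qed.

Lemma continuous_at_pair (T U V : topologicalType) (f : T -> U) (g : T -> V)
    (x : T) : {for x, continuous f} -> {for x, continuous g} ->
  {for x, continuous (fun t => (f t, g t))}.
Proof. by move=> cf cg A; exact: (cvg_pair cf cg). Qed.

Section partial_derivatives.
Variable R : realType.
Implicit Types (f : R * R -> R) (x y t : R).

Let quotient1 f x y :
  (fun h => h^-1 *: ((f \o shift (x, y)) (h *: e1) - f (x, y))) =
  (fun h => h^-1 *: (((fun t => f (t, y)) \o shift x) (h *: 1) - f (x, y))).
Proof.
by apply/funext => h; congr (_ *: (f _ - _)); congr (_, _); rewrite /= ?scaler0 ?add0r.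
Qed.

Let quotient2 f x y :
  (fun h => h^-1 *: ((f \o shift (x, y)) (h *: e2) - f (x, y))) =
  (fun h => h^-1 *: (((fun t => f (x, t)) \o shift y) (h *: 1) - f (x, y))).
Proof.
by apply/funext => h; congr (_ *: (f _ - _)); congr (_, _); rewrite /= ?scaler0 ?add0r.
Qed.

Lemma derive_e1 f x y : 'D_e1 f (x, y) = 'D_1 (fun t => f (t, y)) x.
Proof. by rewrite /derive quotient1. Qed.

Lemma derive_e2 f x y : 'D_e2 f (x, y) = 'D_1 (fun t => f (x, t)) y.
Proof. by rewrite /derive quotient2. Qed.

Lemma derivable_e1 f x y :
  derivable f (x, y) e1 <-> derivable (fun t => f (t, y)) x 1.
Proof. by rewrite /derivable quotient1. Qed.

Lemma derivable_e2 f x y :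
  derivable f (x, y) e2 <-> derivable (fun t => f (x, t)) y 1.
Proof. by rewrite /derivable quotient2. Qed.

Lemma is_derive_e1 f x y df :
  is_derive x 1 (fun t => f (t, y)) df -> is_derive (x, y) e1 f df.
Proof.
move=> h; have [? ?] := h; apply: DeriveDef; first exact/derivable_e1.
by rewrite derive_e1.
Qed.

Lemma is_derive_e2 f x y df :
  is_derive y 1 (fun t => f (x, t)) df -> is_derive (x, y) e2 f df.
Proof.
move=> h; have [? ?] := h; apply: DeriveDef; first exact/derivable_e2.
by rewrite derive_e2.
Qed.

End partial_derivatives.

Section C1_at.
Variable R : realType.
Implicit Types (e z : R * R) (f g : R * R -> R).

(** Regularity in the single direction e, and local, so that it can be checked by replacing f near z
    by whichever formula is valid there. *)
Definition C1_at e f z := [/\ {for z, continuous f},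
  \forall z' \near z, derivable f z' e &
  {for z, continuous (fun z' => 'D_e f z')}].

Lemma near_eq_continuous_at (T U : topologicalType) (h k : T -> U) (x : T) :
  (\forall y \near x, h y = k y) -> {for x, continuous k} ->
  {for x, continuous h}.
Proof.
move=> hk; rewrite /prop_for /continuous_at => ck.
rewrite (nbhs_singleton hk); apply: cvg_trans ck.
by apply: near_eq_cvg; apply: filterS hk => y ->.
Qed.

Lemma near_eq_C1_at e f g z :
  (\forall z' \near z, f z' = g z') -> C1_at e g z -> C1_at e f z.
Proof.
move=> fg [cg dg cdg].
have fg' : \forall z' \near z, {near z', f =1 g} by exact: near_join.
split; first exact: near_eq_continuous_at cg.
- apply: filterS2 fg' dg => z' fgz'; apply: near_eq_derivable.
  by apply: filterS fgz' => ? ->.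
- apply: near_eq_continuous_at cdg.
  by apply: filterS fg' => z'; exact: near_eq_derive.
Qed.

Lemma near_C1_at e f z : C1_at e f z -> derivable f z e.
Proof. by case=> _ /nbhs_singleton. Qed.

Lemma C1_at_cst e (c : R) z : C1_at e (cst c) z.
Proof.
split; [exact: cst_continuous|by near=> z'; exact: derivable_cst|].
apply: (@near_eq_continuous_at _ _ _ (cst 0)); last exact: cst_continuous.
by near=> z'; rewrite derive_cst.
Unshelve. all: by end_near. Qed.

Lemma C1_atM e f g z :
  C1_at e f z -> C1_at e g z -> C1_at e (fun z' => f z' * g z') z.
Proof.
move=> [cf df cdf] [cg dg cdg]; split.
- exact: cvgM.
- by apply: filterS2 df dg => z' ? ?; exact: derivableM.
- apply: (@near_eq_continuous_at _ _ _
    (fun z' => f z' * 'D_e g z' + g z' * 'D_e f z')).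
    by apply: filterS2 df dg => z' df dg; rewrite deriveM.
  by apply: cvgD; exact: cvgM.
Qed.

Lemma is_derive_C1_at e f g z : {for z, continuous f} ->
  (\forall z' \near z, is_derive z' e f (g z')) -> {for z, continuous g} ->
  C1_at e f z.
Proof.
move=> cf fg cg; split => //; first by apply: filterS fg => z' [].
apply: near_eq_continuous_at cg.
by apply: filterS fg => z' [].
Qed.

End C1_at.

(** * Integration by parts on the plane *)

Section integral_derive.
Variable R : realType.
Notation mu := (@lebesgue_measure R).

Lemma integral_derive_eq0 (f : R -> R) (L : R) : 0 < L ->
  (forall x, derivable f x 1) -> continuous (fun x => 'D_1 f x) ->
  (forall x, L < `|x| -> f x = 0) ->
  (\int[mu]_x ('D_1 f x)%:E = 0)%E.
Proof.
move=> L0 df cdf f0.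
have cf : continuous f.
  by move=> x; apply: differentiable_continuous; exact/derivable1_diffP.
(* The hypothesis on the support is strict, so the margin 1 is what makes f vanish at both
   endpoints. *)
pose M := L + 1.
have dfE : (fun x => ('D_1 f x)%:E) =
    (fun x => ('D_1 f x)%:E) \_ `[- M, M] :> (R -> \bar R).
  apply/funext => x; rewrite patchE; case: ifPn => // xM.
  congr EFin; rewrite (@near_eq_derive _ _ _ _ (cst 0)) ?derive_cst//.
  have xL : L < `|x|.
    move: xM; rewrite notin_setE/= in_itv/= => /negP; rewrite -ler_norml -ltNge.
    by apply: lt_trans; rewrite /M; lra.
  have : \forall y \near x, L < `|y|.
    exists (`|x| - L) => /=; first by rewrite subr_gt0.
    by move=> y /= xy; have := ler_normD (x - y) y; rewrite subrK; lra.
  by apply: filterS => y /f0.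
rewrite dfE -integral_mkcond (@continuous_FTC2 _ (fun x => 'D_1 f x) f).
- by rewrite !f0 ?subee// /M ?normrN ger0_norm; lra.
- by rewrite /M; lra.
- exact: continuous_subspaceT.
- split.
  + by move=> *.
  + by apply: cvg_at_right_filter; exact: cf.
  + by apply: cvg_at_left_filter; exact: cf.
- by move=> x _; rewrite derive1E.
Qed.

End integral_derive.

Section plane_integrals.
Variable R : realType.
Notation mu := (@lebesgue_measure R).
Implicit Types (D : set (measurableTypeR R * measurableTypeR R)).
Implicit Types (f u phi : R * R -> R) (z e : R * R).

Let box (L : R) : set (measurableTypeR R * measurableTypeR R) :=
  `[- L, L] `*` `[- L, L].

Let boxP (L : R) z : box L z <-> `|z| <= L.
Proof.
case: z => x y; rewrite prod_normE/= ge_max !ler_norml.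
split=> [[/=]|/andP[? ?]]; first by rewrite !in_itv/= => -> ->.
by split; rewrite /= in_itv.
Qed.

Lemma bounded_support_integrable D f (M L : R) : measurable D ->
  measurable_fun D f -> (forall z, D z -> `|f z| <= M) ->
  (forall z, D z -> L < `|z| -> f z = 0) ->
  lebesgue2.-integrable D (EFin \o f).
Proof.
move=> mD mf fM fL.
have mbox : measurable (box L) by apply: measurableX; exact: measurable_itv.
apply: (@le_integrable _ _ _ _ _ mD _ (EFin \o (cst M \_ (box L)))).
- exact/measurable_EFinP.
- move=> z Dz /=; rewrite lee_fin patchE; case: ifPn => [_|zL].
    by rewrite (le_trans (fM _ Dz))// ler_norm.
  rewrite fL ?normr0// ltNge; apply/negP => /boxP zbox.
  by move: zL; rewrite notin_setE.
- apply: (integrableS measurableT) => //.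
  rewrite -restrict_EFin; apply/integrable_restrict => //; rewrite setTI.
  apply: measurable_bounded_integrable => //.
  + rewrite [ltLHS]product_measure1E; [|exact: measurable_itv..].
    have bnd : (mu `[(- L)%R, L%R] < +oo)%E.
      by rewrite lebesgue_measure_itv/=; case: ifPn => _; rewrite ltry.
    by apply: lte_mul_pinfty => //; rewrite ge0_fin_numE.
  + exists `|M|; split; first exact: num_real.
    by move=> x Mx z _; exact: ltW.
Qed.

Lemma continuous_support_integrable f (L : R) : continuous f ->
  (forall z, L < `|z| -> f z = 0) -> lebesgue2.-integrable setT (EFin \o f).
Proof.
move=> cf fL.
have cbox : compact (box L : set (R * R)).
  by apply: compact_setX; exact: segment_compact.
have /compact_bounded[M [_ /(_ (M + 1) ltac:(lra)) fM]] :
    compact (f @` (box L)).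
  by apply: continuous_compact => //; exact: continuous_subspaceT.
apply: (@bounded_support_integrable _ _ (Num.max 0 (M + 1)) L) => //.
- exact: continuous_measurable_fun2.
- move=> z _; have [zL|Lz] := leP `|z| L.
    by rewrite le_max fM ?orbT//; exists z => //; apply/boxP.
  by rewrite fL// normr0 le_max lexx.
- by move=> z _; exact: fL.
Qed.

Lemma near_norm_gt (V : normedModType R) (L : R) (v : V) : L < `|v| ->
  \forall v' \near v, L < `|v'|.
Proof. by move=> Lv; apply: (@cvgr_norm_gt _ _ _ _ _ id v _ L Lv); exact: cvg_id. Qed.

Lemma integral_slice_eq0 f (y L : R) : 0 < L ->
  (forall x, C1_at e1 f (x, y)) -> (forall x, L < `|x| -> f (x, y) = 0) ->
  (\int[mu]_x ('D_e1 f (x, y))%:E = 0)%E.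
Proof.
move=> L0 C1f f0; under eq_integral do rewrite /= derive_e1.
apply: (@integral_derive_eq0 _ (fun x => f (x, y)) L) => //.
  by move=> x; apply/derivable_e1; exact: near_C1_at.
rewrite (_ : (fun x => _) = (fun x => 'D_e1 f (x, y))); last first.
  by apply/funext => x; rewrite derive_e1.
move=> x; apply: (@continuous_comp _ _ _ (fun x => (x, y)) (fun z => 'D_e1 f z)).
  by apply: continuous_at_pair; [exact: cvg_id|exact: cvg_cst].
by case: (C1f x).
Qed.

(** Fubini in the order that integrates along e first: every inner integral is already 0. *)
Lemma integral_partial_eq0 e f (L : R) : e = e1 \/ e = e2 -> 0 < L ->
  (forall z, C1_at e f z) -> (forall z, L < `|z| -> f z = 0) ->
  (\int[lebesgue2]_z ('D_e f z)%:E = 0)%E.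
Proof.
move=> e12 L0 C1f f0.
have df0 z : L < `|z| -> 'D_e f z = 0.
  move=> Lz; rewrite (@near_eq_derive _ _ _ _ (cst 0)) ?derive_cst//.
  by apply: filterS (near_norm_gt Lz) => y /f0.
have cdf : continuous (fun z => 'D_e f z) by move=> z; case: (C1f z).
have idf := continuous_support_integrable cdf df0.
case: e12 => ee; rewrite ee in C1f df0 cdf idf *.
- rewrite -(integral21_prod_meas1 idf)/= /fubini_G.
  apply: integral0_eq => y _; apply: (integral_slice_eq0 L0) => // x Lx.
  by apply: f0; rewrite prod_normE/= lt_max Lx.
- rewrite -(integral12_prod_meas1 idf)/= /fubini_F.
  apply: integral0_eq => x _; under eq_integral do rewrite /= derive_e2.
  apply: (@integral_derive_eq0 _ (fun y => f (x, y)) L) => //.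
  + by move=> y; apply/derivable_e2; exact: near_C1_at.
  + rewrite (_ : (fun x => _) = (fun y => 'D_e2 f (x, y))); last first.
      by apply/funext => y; rewrite derive_e2.
    move=> y; apply: (@continuous_comp _ _ _ (fun y => (x, y)) (fun z => 'D_e2 f z)); last exact: cdf.
    by apply: continuous_at_pair; [exact: cvg_cst|exact: cvg_id].
  + by move=> y Ly; apply: f0; rewrite prod_normE/= lt_max Ly orbT.
Qed.

Section weak_partial.
Variables (Omega : set (R * R)) (phi : R * R -> R).
Hypotheses (oO : open Omega) (tphi : test_function Omega phi).

Lemma test_function_C1 e z : e = e1 \/ e = e2 -> C1_at e phi z.
Proof.
case: tphi => /(_ 1%N) [cphi [d1 d2 [c1 _] [c2 _]]] _ _.
by case=> ->; split; [exact: cphi|near=> z'; exact: d1|exact: c1|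
                      exact: cphi|near=> z'; exact: d2|exact: c2].
Unshelve. all: by end_near. Qed.

(** The closed support lies inside [Omega], so phi vanishes on a neighbourhood even of boundary
    points. This is what makes extensions by zero of products with phi regular. *)
Lemma test_function_near0 z : ~ Omega z -> \forall z' \near z, phi z' = 0.
Proof.
case: tphi => _ _ supp nOz.
have : nbhs z (~` closure [set x | phi x != 0]).
  apply: open_nbhs_nbhs; split; last by move=> /supp.
  exact/closed_openC/closed_closure.
apply: filterS => z' nz'; apply/eqP/negP => /negP z'0.
by apply: nz'; exact: subset_closure.
Qed.

Lemma test_function_bounded : exists2 L : R, 0 < L &
  forall z, L < `|z| -> phi z = 0.
Proof.
case: tphi => _ /compact_bounded[M [_ /(_ (M + 1) ltac:(lra)) phiM]] _.
exists (Num.max 1 (M + 1)); first by rewrite lt_max ltr01.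
move=> z; rewrite gt_max => /andP[_ Mz]; apply/eqP/negP => /negP z0.
have /phiM/= : closure [set x | phi x != 0] z by exact: subset_closure.
by rewrite leNgt Mz.
Qed.

(* The product [u * phi], extended by zero, is C^1 on the whole plane. *)
Lemma integral_by_parts u e : e = e1 \/ e = e2 ->
  (forall z, Omega z -> C1_at e u z) ->
  [/\ lebesgue2.-integrable Omega (EFin \o (fun z => u z * 'D_e phi z)),
      lebesgue2.-integrable Omega (EFin \o (fun z => 'D_e u z * phi z)) &
      (\int[lebesgue2]_(z in Omega) (u z * 'D_e phi z + 'D_e u z * phi z)%:E
       = 0)%E].
Proof.
move=> e12 C1u.
have C1phi z : C1_at e phi z by exact: test_function_C1.
have [L L0 phi0] := test_function_bounded.
have ext0 f z : Omega z -> \forall z' \near z, (f \_ Omega) z' = f z'.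
  move=> Oz; have : nbhs z Omega by exact: open_nbhs_nbhs.
  by apply: filterS => z' ?; rewrite patchE mem_set.
have near0 z : ~ Omega z ->
    \forall z' \near z, phi z' = 0 /\ 'D_e phi z' = 0.
  move=> /test_function_near0 nz.
  apply: filterS2 nz (near_join nz) => z' -> nz'; split => //.
  by rewrite (@near_eq_derive _ _ _ _ (cst 0)) ?derive_cst.
have cont f g : {in Omega, continuous f} -> {in Omega, continuous g} ->
    (forall z, phi z = 0 -> 'D_e phi z = 0 -> g z = 0) ->
    continuous ((fun z => f z * g z) \_ Omega).
  move=> cf cg g0 z; have [Oz|nOz] := pselect (Omega z).
    apply: near_eq_continuous_at (ext0 _ _ Oz) _.
    by apply: cvgM; [exact/cf/mem_set|exact/cg/mem_set].
  apply: (@near_eq_continuous_at _ _ _ (cst 0)); last exact: cst_continuous.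
  apply: filterS (near0 _ nOz) => z' [? ?]; rewrite patchE.
  by case: ifP => // _; rewrite g0// mulr0.
have supp f g : (forall z, phi z = 0 -> 'D_e phi z = 0 -> g z = 0) ->
    forall z, L < `|z| -> ((fun z => f z * g z) \_ Omega) z = 0.
  move=> g0 z Lz; rewrite patchE; case: ifP => // _; rewrite g0 ?mulr0 ?phi0//.
  rewrite (@near_eq_derive _ _ _ _ (cst 0)) ?derive_cst//.
  by apply: filterS (near_norm_gt Lz) => y /phi0.
have cuM := cont u (fun z => 'D_e phi z).
have cu : {in Omega, continuous u} by move=> z /set_mem /C1u[].
have cdu : {in Omega, continuous (fun z => 'D_e u z)}.
  by move=> z /set_mem /C1u[].
have cphi : {in Omega, continuous phi} by move=> z _; case: (C1phi z).
have cdphi : {in Omega, continuous (fun z => 'D_e phi z)}.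
  by move=> z _; case: (C1phi z).
have mO := open_measurable2 oO.
have i1 : lebesgue2.-integrable Omega (EFin \o (fun z => u z * 'D_e phi z)).
  apply/integrable_mkcond => //; rewrite restrict_EFin.
  apply: (@continuous_support_integrable _ L); first exact: cont.
  exact: supp.
have i2 : lebesgue2.-integrable Omega (EFin \o (fun z => 'D_e u z * phi z)).
  apply/integrable_mkcond => //; rewrite restrict_EFin.
  apply: (@continuous_support_integrable _ L); first exact: cont.
  exact: supp.
split => //.
pose w := (fun z => u z * phi z) \_ Omega.
have C1w z : C1_at e w z.
  have [Oz|nOz] := pselect (Omega z).
    apply: near_eq_C1_at (ext0 _ _ Oz) _.
    by apply: C1_atM => //; exact: C1u.
  apply: (@near_eq_C1_at _ _ _ (cst 0)); last exact: C1_at_cst.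
  apply: filterS (near0 _ nOz) => z' [p0 _]; rewrite /w patchE.
  by case: ifP => // _; rewrite p0 mulr0.
have := integral_partial_eq0 e12 L0 C1w (supp _ _ (fun z p0 _ => p0)).
rewrite (_ : (fun z => ('D_e w z)%:E) =
  (fun z => (u z * 'D_e phi z + 'D_e u z * phi z)%:E) \_ Omega).
  by rewrite -integral_mkcond.
apply/funext => z; rewrite patchE; case: ifPn => [/set_mem Oz|].
  congr EFin; rewrite (near_eq_derive _ (ext0 _ _ Oz)).
  rewrite deriveM; [|exact: near_C1_at (C1u _ Oz)|exact: near_C1_at].
  by rewrite [X in _ + X = _]mulrC.
rewrite notin_setE => nOz; congr EFin.
rewrite (@near_eq_derive _ _ _ _ (cst 0)) ?derive_cst//.
apply: filterS (near0 _ nOz) => z' [p0 _]; rewrite /w patchE.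
by case: ifP => // _; rewrite p0 mulr0.
Qed.

Lemma weak_partial_derive u e : e = e1 \/ e = e2 ->
  (forall z, Omega z -> C1_at e u z) ->
  (\int[lebesgue2]_(z in Omega) (u z * 'D_e phi z)%:E =
   - \int[lebesgue2]_(z in Omega) ('D_e u z * phi z)%:E)%E.
Proof.
move=> e12 C1u; have [i1 i2 i0] := integral_by_parts e12 C1u.
have mO := open_measurable2 oO.
move: i0; under eq_integral do rewrite EFinD.
rewrite integralD//=.
move: (integrable_fin_num mO i1) (integrable_fin_num mO i2) => /=.
move: (integral _ _ _) (integral _ _ _) => [a| |]// [b| |]// _ _.
by rewrite -EFinD => -[ab]; congr EFin; lra.
Qed.

End weak_partial.

End plane_integrals.

(** * Smooth functions and cut-offs *)

Section is_derive_fun.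
Variable R : realType.
Implicit Types (f g : R -> R) (x : R).

Lemma is_derive_addf f g x df dg : is_derive x 1 f df -> is_derive x 1 g dg ->
  is_derive x 1 (fun t => f t + g t) (df + dg).
Proof. exact: is_deriveD. Qed.

Lemma is_derive_subf f g x df dg : is_derive x 1 f df -> is_derive x 1 g dg ->
  is_derive x 1 (fun t => f t - g t) (df - dg).
Proof. exact: is_deriveB. Qed.

Lemma is_derive_mulf f g x df dg : is_derive x 1 f df -> is_derive x 1 g dg ->
  is_derive x 1 (fun t => f t * g t) (df * g x + f x * dg).
Proof.
move=> hf hg; have := is_deriveM hf hg.
by rewrite addrC [X in X + _]mulrC.
Qed.

Lemma is_derive_expf f n x df : is_derive x 1 f df ->
  is_derive x 1 (fun t => f t ^+ n) (n%:R * f x ^+ n.-1 * df).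
Proof.
move=> hf; have := is_deriveX n hf.
by rewrite (_ : f ^+ n = (fun t => f t ^+ n))//; apply/funext => t; rewrite fctE.
Qed.

Lemma is_derive_invf f x df : f x != 0 -> is_derive x 1 f df ->
  is_derive x 1 (fun t => (f t)^-1) (- (f x) ^- 2 * df).
Proof. by move=> fx0 hf; exact: is_deriveV. Qed.

Lemma is_derive_compf f g x df dg : is_derive (g x) 1 f df ->
  is_derive x 1 g dg -> is_derive x 1 (fun t => f (g t)) (df * dg).
Proof. exact: is_derive1_comp. Qed.

Lemma is_derive_divf f g x df dg : g x != 0 -> is_derive x 1 f df ->
  is_derive x 1 g dg ->
  is_derive x 1 (fun t => f t / g t) ((df * g x - f x * dg) / g x ^+ 2).
Proof.
move=> gx0 hf hg; have := is_derive_mulf hf (is_derive_invf gx0 hg).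
by move=> /is_derive_eq; apply; field.
Qed.

Lemma is_derive_continuous f x df : is_derive x 1 f df ->
  {for x, continuous f}.
Proof.
by case=> df' _; apply: differentiable_continuous; exact/derivable1_diffP.
Qed.

(** Intended for [flat] at 0, where the two branches of the definition meet and the differentiation
    rules do not apply. *)
Lemma quadratic_is_derive f x df (c : R) :
  (forall t, `|f t - f x - df * (t - x)| <= c * (t - x) ^+ 2) ->
  is_derive x 1 f df.
Proof.
move=> fq.
suff H : (fun h => h^-1 *: ((f \o shift x) (h *: 1) - f x)) @ 0^' --> df.
  by apply: DeriveDef; [apply/cvg_ex; exists df|exact/cvg_lim].
apply/cvgrPdist_le => e e0; near=> h.
have h0 : h != 0 by near: h; exact: nbhs_dnbhs_neq.
have hc : (`|c| + 1) * `|h| <= e.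
  rewrite mulrC -ler_pdivlMr ?ltr_wpDl//; near: h; apply: dnbhs0_le.
  by rewrite divr_gt0// ltr_wpDl.
have := fq (h + x); rewrite addrK /= [h *: 1]mulr1.
rewrite -[X in X - _ - _]/(f (h + x)) => fh.
rewrite distrC -(ler_pM2r (x := `|h|)) ?normr_gt0// -normrM.
rewrite (_ : (_ - df) * h = f (h + x) - f x - df * h); last first.
  by rewrite /GRing.scale/=; field.
apply: (le_trans fh).
apply: (@le_trans _ _ ((`|c| + 1) * `|h| ^+ 2)).
  rewrite real_normK ?num_real//; apply: ler_wpM2r; first exact: sqr_ge0.
  by rewrite (le_trans (ler_norm c))// ler_wpDr.
by rewrite expr2 mulrA ler_wpM2r.
Unshelve. all: by end_near. Qed.

End is_derive_fun.

Section smooth_functions.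
Variable R : realType.
Implicit Types (f g a c : R -> R) (x : R).

Fixpoint smooth_upto (k : nat) f : Prop :=
  continuous f /\ if k is k'.+1 then
    (forall x, derivable f x 1) /\ smooth_upto k' (fun x => 'D_1 f x) else True.

Definition smooth f := forall k, smooth_upto k f.

Lemma smooth_uptoW k f : smooth_upto k.+1 f -> smooth_upto k f.
Proof.
elim: k f => [f [cf _]//|k IH f [cf [df sf]]].
by split => //; split => //; exact: IH.
Qed.

Lemma smooth_upto_continuous k f : smooth_upto k f -> continuous f.
Proof. by case: k => [|k] []. Qed.

Lemma smooth_uptoS k f g : (forall x, is_derive x 1 f (g x)) ->
  smooth_upto k g -> smooth_upto k.+1 f.
Proof.
move=> fg sg; split; first by move=> x; exact: is_derive_continuous (fg x).
split; first by move=> x; case: (fg x).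
by rewrite (_ : (fun x => _) = g)//; apply/funext => x; case: (fg x).
Qed.

Lemma smooth_upto_is_derive k f : smooth_upto k.+1 f ->
  (forall x, is_derive x 1 f ('D_1 f x)) /\ smooth_upto k (fun x => 'D_1 f x).
Proof. by case=> _ [df sf]; split => // x; apply: DeriveDef. Qed.

Lemma smooth_uptoD k f g : smooth_upto k f -> smooth_upto k g ->
  smooth_upto k (fun x => f x + g x).
Proof.
elim: k f g => [f g [cf _] [cg _]|k IH f g].
  by split => // x; apply: cvgD; [exact: cf|exact: cg].
move=> /smooth_upto_is_derive[df sf] /smooth_upto_is_derive[dg sg].
exact: smooth_uptoS (fun x => is_derive_addf (df x) (dg x)) (IH _ _ sf sg).
Qed.

Lemma smooth_uptoM k f g : smooth_upto k f -> smooth_upto k g ->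
  smooth_upto k (fun x => f x * g x).
Proof.
elim: k f g => [f g [cf _] [cg _]|k IH f g].
  by split => // x; apply: cvgM; [exact: cf|exact: cg].
move=> sf sg; have [df sdf] := smooth_upto_is_derive sf.
have [dg sdg] := smooth_upto_is_derive sg.
apply: smooth_uptoS (fun x => is_derive_mulf (df x) (dg x)) _.
by apply: smooth_uptoD; apply: IH => //; exact: smooth_uptoW.
Qed.

Lemma smooth_cst (r : R) : smooth (cst r).
Proof.
move=> k; elim: k r => [r|k IH r]; first by split => //; exact: cst_continuous.
exact: smooth_uptoS (fun x => is_derive_cst r x 1) (IH 0).
Qed.

Lemma smoothD f g : smooth f -> smooth g -> smooth (fun x => f x + g x).
Proof. by move=> sf sg k; exact: smooth_uptoD. Qed.

Lemma smoothM f g : smooth f -> smooth g -> smooth (fun x => f x * g x).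
Proof. by move=> sf sg k; exact: smooth_uptoM. Qed.

Lemma smoothX f n : smooth f -> smooth (fun x => f x ^+ n).
Proof.
move=> sf; elim: n => [|n IH]; first exact: smooth_cst.
rewrite (_ : (fun x => _) = (fun x => f x * f x ^+ n)); first exact: smoothM.
by apply/funext => x; rewrite exprS.
Qed.

Lemma smoothB f g : smooth f -> smooth g -> smooth (fun x => f x - g x).
Proof.
move=> sf sg.
rewrite (_ : (fun x => _) = (fun x => f x + (cst (-1)) x * g x)).
  by apply: smoothD => //; apply: smoothM => //; exact: smooth_cst.
by apply/funext => x; rewrite mulN1r.
Qed.

Lemma smooth_prod (I : Type) (r : seq I) (F : I -> R -> R) :
  (forall i, smooth (F i)) -> smooth (fun x => \prod_(i <- r) F i x).
Proof.
move=> sF; elim: r => [|i r IH].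
  rewrite (_ : (fun x => _) = cst 1); first exact: smooth_cst.
  by apply/funext => x; rewrite big_nil.
rewrite (_ : (fun x => _) = (fun x => F i x * \prod_(j <- r) F j x)).
  exact: smoothM.
by apply/funext => x; rewrite big_cons.
Qed.

Lemma smooth_comp_affine f (u v : R) : smooth f ->
  smooth (fun x => f (u * x + v)).
Proof.
move=> sf k; move: {sf}(sf k); elim: k f => [f [cf _]|k IH f].
  split => // x; apply: (@continuous_comp _ _ _ (fun x => u * x + v) f).
    by apply: cvgD; [apply: cvgM; [exact: cvg_cst|exact: cvg_id]|exact: cvg_cst].
  exact: cf.
move=> /smooth_upto_is_derive[df sdf].
have daff x : is_derive x 1 (fun x => u * x + v) u.
  have := is_derive_addf (is_derive_mulf (is_derive_cst u x 1)
    (is_derive_id x 1)) (is_derive_cst v x 1).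
  by move=> /is_derive_eq; apply; rewrite /cst/=; ring.
have dcomp x : is_derive x 1 (fun t => f (u * t + v)) ('D_1 f (u * x + v) * u).
  exact: (is_derive_compf (g := fun t => u * t + v) (df _) (daff x)).
apply: (smooth_uptoS dcomp).
apply: (@smooth_uptoM _ _ (cst u)); last exact: smooth_cst.
exact: (IH (fun x => 'D_1 f x)).
Qed.

End smooth_functions.

Section hump.
Variable R : realType.
Implicit Types (t q r : R).

(* All derivatives of [flat 0], i.e. of exp(-1/t) extended by 0, are
   combinations of the functions [flat j]. *)
Definition flat (j : nat) t : R :=
  if 0 < t then t^-1 ^+ j * expR (- t^-1) else 0.

Lemma flat_eq0 j t : t <= 0 -> flat j t = 0.
Proof. by rewrite /flat leNgt; case: ltP. Qed.

Lemma flat_gt0 j t : 0 < t -> 0 < flat j t.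
Proof. by rewrite /flat => t0; rewrite t0 mulr_gt0 ?exprn_gt0 ?invr_gt0 ?expR_gt0. Qed.

Lemma flat_ge0 j t : 0 <= flat j t.
Proof. by have [/(flat_eq0 j)->|/(flat_gt0 j)/ltW] := leP t 0. Qed.

Lemma flat0_le1 t : flat 0 t <= 1.
Proof.
have [/(flat_eq0 0)->//|t0] := leP t 0.
by rewrite /flat t0 expr0 mul1r expR_le1 oppr_le0 invr_ge0 ltW.
Qed.

(** With u = 1/t, a single term of the exponential series gives u^(j+2) / (j+2)! <= exp u. Two more
    powers than j are taken so that a quadratic bound remains, which forces derivative 0 at the
    origin. *)
Lemma flat_le_sqr j t : flat j t <= (j.+2)`!%:R * t ^+ 2.
Proof.
have [/(flat_eq0 j)->|t0] := leP t 0; first by rewrite mulr_ge0 ?sqr_ge0.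
have u0 : 0 < t^-1 by rewrite invr_gt0.
have F0 : 0 < (j.+2)`!%:R :> R by rewrite ltr0n fact_gt0.
rewrite /flat t0 expRN ler_pdivrMr ?expR_gt0//.
apply: (@le_trans _ _ ((j.+2)`!%:R * t ^+ 2 * (t^-1 ^+ j.+2 / (j.+2)`!%:R))).
  rewrite !exprS; set X := _ ^+ j; rewrite le_eqVlt; apply/orP; left.
  by apply/eqP; field; rewrite gt_eqF//= gt_eqF.
apply: ler_wpM2l; first by rewrite mulr_ge0 ?sqr_ge0// ltW.
by apply: le_trans (expR_ge1Dxn j.+1 (ltW u0)); rewrite lerDr.
Qed.

Lemma is_derive_flat j t :
  is_derive t 1 (flat j) (flat j.+2 t - j%:R * flat j.+1 t).
Proof.
have [t0|t0|->] := ltgtP t 0.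
- rewrite !flat_eq0 ?(ltW t0)// mulr0 subr0.
  apply: near_eq_is_derive (is_derive_cst (0 : R) t 1).
  near=> u; rewrite /cst flat_eq0// ltW//; near: u; exact: lt_nbhsl.
- have dinv : is_derive t 1 (fun u : R => u^-1) (- t ^- 2 * 1).
    by apply: (@is_derive_invf _ id t 1 _ (is_derive_id t 1)); rewrite gt_eqF.
  have dN : is_derive t 1 (fun u : R => - u^-1) (- (- t ^- 2 * 1)).
    exact: is_deriveN.
  have := is_derive_mulf (is_derive_expf j dinv)
    (is_derive_compf (is_derive_expR _) dN).
  move=> dflat.
  apply: near_eq_is_derive (is_derive_eq dflat _).
    near=> u; rewrite /flat ifT//; near: u; exact: lt_nbhsr.
  rewrite /flat t0.
  case: {dflat} j => [|j] /=; rewrite ?exprS ?expr0; last set X := _ ^+ j.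
    by field; rewrite gt_eqF.
  by rewrite -[j.+1%:R]natr1; field; rewrite gt_eqF.
- rewrite !(@flat_eq0 _ 0)// mulr0 subr0.
  apply: (@quadratic_is_derive _ _ _ _ (j.+2)`!%:R) => u.
  rewrite (@flat_eq0 _ 0)// mul0r !subr0 ger0_norm ?flat_ge0//.
  exact: flat_le_sqr.
Unshelve. all: by end_near. Qed.

Lemma smooth_flat j : smooth (flat j).
Proof.
move=> k; elim: k j => [|k IH] j.
  by split => // t; exact: is_derive_continuous (is_derive_flat j t).
apply: smooth_uptoS (is_derive_flat j) _.
rewrite (_ : (fun x => _) =
    (fun x => flat j.+2 x + (cst (- j%:R) x * flat j.+1 x))).
  apply: smooth_uptoD => //; apply: smooth_uptoM => //; exact: smooth_cst.
by apply/funext => x; rewrite mulNr.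
Qed.

Definition hump q r t := flat 0 (t - q) * flat 0 (r - t).

Lemma hump_ge0 q r t : 0 <= hump q r t.
Proof. by rewrite mulr_ge0 ?flat_ge0. Qed.

Lemma hump_le1 q r t : hump q r t <= 1.
Proof. by rewrite mulr_ile1 ?flat_ge0 ?flat0_le1. Qed.

Lemma hump_gt0 q r t : q < t < r -> 0 < hump q r t.
Proof. by move=> /andP[qt tr]; rewrite mulr_gt0 ?flat_gt0 ?subr_gt0. Qed.

Lemma hump_eq0 q r t : ~~ (q < t < r) -> hump q r t = 0.
Proof.
rewrite negb_and -!leNgt => /orP[tq|rt]; rewrite /hump.
  by rewrite flat_eq0 ?mul0r// subr_le0.
by rewrite [X in _ * X]flat_eq0 ?mulr0// subr_le0.
Qed.

Lemma smooth_hump q r : smooth (hump q r).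
Proof.
apply: smoothM.
  rewrite (_ : (fun x => _) = (fun x => flat 0 (1 * x + - q))).
    exact/smooth_comp_affine/smooth_flat.
  by apply/funext => x; rewrite mul1r.
rewrite (_ : (fun x => _) = (fun x => flat 0 (-1 * x + r))).
  exact/smooth_comp_affine/smooth_flat.
by apply/funext => x; rewrite mulN1r addrC.
Qed.

(** The logarithmic derivative of the hump is (t - q)^-2 - (r - t)^-2, which is positive as long as
    t is closer to q than to r. *)
Lemma derive_hump_gt0 q r t : q < t -> t < (q + r) / 2 ->
  0 < 'D_1 (hump q r) t.
Proof.
move=> qt tr.
have d1 : is_derive t 1 (fun t => flat 0 (t - q)) (flat 2 (t - q) * 1).
  apply: is_derive_compf.
    by have := is_derive_flat 0 (t - q); rewrite mul0r subr0.
  by have := is_deriveB (is_derive_id t 1) (is_derive_cst q t 1); rewrite subr0.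
have d2 : is_derive t 1 (fun t => flat 0 (r - t)) (flat 2 (r - t) * -1).
  apply: is_derive_compf.
    by have := is_derive_flat 0 (r - t); rewrite mul0r subr0.
  by have := is_deriveB (is_derive_cst r t 1) (is_derive_id t 1); rewrite sub0r.
have [_ ->] := is_derive_mulf d1 d2.
have a0 : 0 < t - q by lra.
have b0 : 0 < r - t by lra.
rewrite mulr1 mulrN1 /flat a0 b0 !expr0 !mul1r.
rewrite -mulrA mulrN [X in _ - X]mulrCA -mulrBl mulr_gt0//; last first.
  by rewrite mulr_gt0 ?expR_gt0.
rewrite subr_gt0 ltr_pXn2r ?nnegrE ?invr_ge0 ?ltW//.
rewrite ltf_pV2 ?posrE //; lra.
Qed.

End hump.

Section tensor_test_functions.
Variable R : realType.
Implicit Types (a c : R -> R).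

Definition tensor a c (z : R * R) := a z.1 * c z.2.

Lemma derive_tensor_e1 a c x y :
  derivable a x 1 -> 'D_e1 (tensor a c) (x, y) = 'D_1 a x * c y.
Proof.
move=> da; rewrite derive_e1 /tensor/=.
have := is_derive_mulf (DeriveDef da erefl) (is_derive_cst (c y) x 1).
by case=> _ ->; rewrite mulr0 addr0.
Qed.

Lemma derive_tensor_e2 a c x y :
  derivable c y 1 -> 'D_e2 (tensor a c) (x, y) = a x * 'D_1 c y.
Proof.
move=> dc; rewrite derive_e2 /tensor/=.
have := is_derive_mulf (is_derive_cst (a x) y 1) (DeriveDef dc erefl).
by case=> _ ->; rewrite mul0r add0r.
Qed.

Lemma continuous_tensor a c : continuous a -> continuous c ->
  continuous (tensor a c).
Proof.
move=> ca cc z; apply: cvgM.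
  by apply: (@continuous_comp _ _ _ fst a); [exact: cvg_fst|exact: ca].
by apply: (@continuous_comp _ _ _ snd c); [exact: cvg_snd|exact: cc].
Qed.

Lemma Ck_tensor k a c : smooth_upto k a -> smooth_upto k c -> Ck k (tensor a c).
Proof.
elim: k a c => [a c [ca _] [cc _]|k IH a c sa sc].
  by split => //; exact: continuous_tensor.
have [da sda] := smooth_upto_is_derive sa.
have [dc sdc] := smooth_upto_is_derive sc.
split.
  by apply: continuous_tensor; [exact: smooth_upto_continuous sa|
    exact: smooth_upto_continuous sc].
split.
- move=> [x y]; apply/derivable_e1.
  by case: (is_derive_mulf (da x) (is_derive_cst (c y) x 1)).
- move=> [x y]; apply/derivable_e2.
  by case: (is_derive_mulf (is_derive_cst (a x) y 1) (dc y)).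
- rewrite (_ : (fun x => _) = tensor (fun x => 'D_1 a x) c).
    by apply: IH => //; exact: smooth_uptoW.
  by apply/funext => -[x y]; rewrite derive_tensor_e1//; case: (da x).
- rewrite (_ : (fun x => _) = tensor a (fun x => 'D_1 c x)).
    by apply: IH => //; exact: smooth_uptoW.
  by apply/funext => -[x y]; rewrite derive_tensor_e2//; case: (dc y).
Qed.

(** Only the first variable keeps the support inside [Omega]: in the main use K misses C, so the
    whole vertical strip over K avoids C x F. *)
Lemma test_function_tensor (Omega : set (R * R)) a c (K : set R) (L : R) :
  smooth a -> smooth c -> closed K -> K `*` setT `<=` Omega ->
  (forall x, a x != 0 -> K x) ->
  (forall x, L < `|x| -> a x = 0) -> (forall y, L < `|y| -> c y = 0) ->
  test_function Omega (tensor a c).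
Proof.
move=> sa sc cK KO aK aL cL.
have cKT : closed (K `*` [set: R]).
  rewrite (_ : K `*` setT = fst @^-1` K).
    by apply: closed_comp => // z _; exact: cvg_fst.
  by apply/seteqP; split => [z []//|z].
have cbox : compact (`[- L, L] `*` `[- L, L] : set (R * R)).
  by apply: compact_setX; exact: segment_compact.
have supp0 (z : R * R) : tensor a c z != 0 -> a z.1 != 0 /\ c z.2 != 0.
  by rewrite /tensor mulf_eq0 negb_or => /andP.
split; first by move=> k; exact: Ck_tensor.
  apply: (subclosed_compact _ cbox); first exact: closed_closure.
  have /closure_id -> : closed (`[- L, L] `*` `[- L, L] : set (R * R)).
    exact: (compact_closed (@norm_hausdorff _ _) cbox).
  apply: closure_subset => z /supp0[az cz]; split => /=; rewrite in_itv/=.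
    by rewrite -ler_norml leNgt; apply/negP => /aL /eqP; exact/negP.
  by rewrite -ler_norml leNgt; apply/negP => /cL /eqP; exact/negP.
apply: subset_trans KO; move/closure_id : cKT => ->.
by apply: closure_subset => z /supp0[/aK].
Qed.

(** Let theta_i be the humps of the rational intervals whose closure misses C, and take chi_n = 1 -
    prod_(i < n) (1 - theta_i)^n. It lives on finitely many closed intervals away from C. Off C some
    theta_i is positive but possibly small, and the n-th powers then drive the product to 0. No
    bound on the derivatives of chi_n is sought. *)
Lemma smooth_cutoffs (C : set R) : closed C ->
  exists chi : nat -> R -> R, [/\ forall n, smooth (chi n),
    forall n x, 0 <= chi n x <= 1,
    forall n, exists K, [/\ closed K, K `<=` ~` C &
      forall x, chi n x != 0 -> K x] &
    forall x, ~ C x -> chi n x @[n --> \oo] --> (1 : R)].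
Proof.
move=> cC.
pose F (i : nat) : rat * rat := odflt (0, 0) (unpickle i).
pose K i : set R := `[ratr (F i).1, ratr (F i).2]%classic.
pose th i := if `[< K i `<=` ~` C >] then hump (ratr (F i).1) (ratr (F i).2)
             else cst (0 : R).
have th01 i x : 0 <= th i x <= 1.
  by rewrite /th; case: ifP => _; rewrite ?hump_ge0 ?hump_le1//= lexx ler01.
have th1 i x : 0 <= 1 - th i x <= 1.
  by have /andP[? ?] := th01 i x; apply/andP; split; lra.
pose P n x := \prod_(i < n) (1 - th i x) ^+ n.
have P01 n x : 0 <= P n x <= 1.
  apply/andP; split.
    by apply: prodr_ge0 => i _; apply: exprn_ge0; case/andP: (th1 i x).
  apply: prodr_ile1 => i _; have /andP[? ?] := th1 i x.
  by rewrite exprn_ge0//= exprn_ile1.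
exists (fun n x => 1 - P n x); split.
- move=> n; apply: smoothB; first exact: smooth_cst.
  apply: smooth_prod => i; apply: smoothX; apply: smoothB.
    exact: smooth_cst.
  by rewrite /th; case: ifP => _; [exact: smooth_hump|exact: smooth_cst].
- by move=> n x; have /andP[? ?] := P01 n x; apply/andP; split; lra.
- move=> n; pose Kc i := if `[< K i `<=` ~` C >] then K i else set0.
  exists (\big[setU/set0]_(i < n) Kc i); split.
  + apply: closed_bigsetU => i _; rewrite /Kc.
    by case: ifP => _; [exact: itv_closed|exact: closed0].
  + rewrite -bigcup_mkord => x [i _]; rewrite /Kc; case: ifPn => //.
    by move=> /asboolP; exact.
  + move=> x; rewrite -bigcup_mkord; apply: contra_neqP => nK.
    rewrite /P big1 ?subrr// => i _; rewrite (_ : th i x = 0) ?subr0 ?expr1n//.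
    rewrite /th; case: ifPn => // iC; apply: hump_eq0; apply/negP => /andP[? ?].
    apply: nK; exists i => /=; first exact: ltn_ord.
    by rewrite /Kc iC /K/= in_itv/= !ltW.
- move=> x nCx.
  have /nbhs_ballP[e /= e0 eC] : nbhs x (~` C).
    by apply: open_nbhs_nbhs; split => //; exact: closed_openC.
  have [q] := rat_in_itvoo (ltac:(lra) : x - e < x).
  rewrite in_itv/= => /andP[q1 q2].
  have [r] := rat_in_itvoo (ltac:(lra) : x < x + e).
  rewrite in_itv/= => /andP[r1 r2].
  pose i := pickle (q, r).
  have Fi : F i = (q, r) by rewrite /F /i pickleK.
  have thi : 0 < th i x.
    rewrite /th ifT; first by rewrite Fi hump_gt0//= q2.
    apply/asboolP => y; rewrite /K Fi/= in_itv/= => /andP[? ?]; apply: eC.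
    by rewrite /ball/= ltr_norml; apply/andP; split; lra.
  rewrite -[X in _ --> X]subr0; apply: cvgB; first exact: cvg_cst.
  apply: (@squeeze_cvgr _ _ _ _ (cst 0) (fun n => (1 - th i x) ^+ n)).
  + near=> n; apply/andP; split; first by case/andP: (P01 n x).
    have iltn : (i < n)%N by near: n; exact: nbhs_infty_gt.
    rewrite /P (bigD1 (Ordinal iltn))//= -[leRHS]mulr1.
    have /andP[? ?] := th1 i x.
    apply: ler_wpM2l; first exact: exprn_ge0.
    apply: prodr_ile1 => j _; have /andP[? ?] := th1 j x.
    by rewrite exprn_ge0//= exprn_ile1.
  + exact: cvg_cst.
  + apply: cvg_expr; have /andP[? ?] := th1 i x.
    by rewrite ger0_norm//; lra.
Unshelve. all: by end_near. Qed.

End tensor_test_functions.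

(** * Hausdorff content and the profile functions *)

Lemma eseries_finite (R : realType) (n : nat) (f : nat -> \bar R) :
  (forall i, 0 <= f i)%E -> (forall i, (n <= i)%N -> f i = 0%E) ->
  (\sum_(i <oo) f i = \sum_(i < n) f i)%E.
Proof.
move=> f0 fn; rewrite (nneseries_split _ n)// [X in (_ + X)%E]eseries0 ?adde0.
  by rewrite add0n big_mkord.
by move=> i; rewrite add0n => ni _; exact: fn.
Qed.

Section hausdorff_content.
Variable R : realType.
Variables (s delta : R).
Hypotheses (s0 : 0 < s) (delta0 : 0 < delta).
Implicit Types (A B U : set R) (x y : R).
Local Open Scope ereal_scope.

Notation content := (hausdorff_content s delta).

Lemma hausdorff_gauge_ge0 U : 0 <= hausdorff_gauge s U.
Proof. by rewrite /hausdorff_gauge; case: ifP => // _; exact: poweR_ge0. Qed.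

Lemma hausdorff_gauge0 : hausdorff_gauge s set0 = 0.
Proof. by rewrite /hausdorff_gauge eqxx. Qed.

Lemma diam_le U (r : R) : (forall x y, U x -> U y -> (x <= y)%R -> (y - x <= r)%R) ->
  diam U <= r%:E.
Proof.
move=> Ur; apply: ge_ereal_sup => _ [x [y [Ux Uy ->]]]; rewrite lee_fin.
have [xy|/ltW yx] := leP x y.
  by rewrite ler0_norm ?subr_le0// opprB Ur.
by rewrite ger0_norm ?subr_ge0// Ur.
Qed.

Lemma hausdorff_gauge_le U (r : R) : (0 <= r)%R -> diam U <= r%:E ->
  hausdorff_gauge s U <= (r `^ s)%:E.
Proof.
move=> r0 Ur; rewrite /hausdorff_gauge; case: ifPn => [_|/set0P[x Ux]].
  by rewrite lee_fin powR_ge0.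
have d0 : 0 <= diam U.
  apply: ereal_sup_ubound; exists x, x; split => //.
  by rewrite subrr normr0.
move: d0 Ur; case: (diam U) => // d; rewrite !lee_fin => d0 dr.
by rewrite ge0_ler_powR ?nnegrE// ltW.
Qed.

(** The content is the outer measure generated by [gauge_delta]: the value +oo excludes covers by
    sets wider than delta, and the sigma-algebra of all subsets makes every other cover admissible.
    Monotonicity and countable subadditivity are then inherited. *)
Let discreteR := g_sigma_algebraType [set: set R].
Let gauge_delta U := if diam U <= delta%:E then hausdorff_gauge s U else +oo.

Let gauge_delta_ge0 U : 0 <= gauge_delta U.
Proof. by rewrite /gauge_delta; case: ifP => // _; exact: hausdorff_gauge_ge0. Qed.

Let contentE A : content A = mu_ext (gauge_delta : set discreteR -> \bar R) A.
Proof.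
apply/eqP; rewrite eq_le; apply/andP; split.
  apply: le_ereal_inf_tmp => _ [B [_ AB] <-].
  have [BD|/existsNP[j /negP jD]] := pselect (forall j, diam (B j) <= delta%:E).
    apply: ereal_inf_lbound; exists B; split => //.
    by apply: eq_eseriesr => j _; rewrite /gauge_delta BD.
  rewrite (@eseries_pinfty _ _ _ j) ?leey//.
    by move=> n _; rewrite gt_eqF// (lt_le_trans _ (gauge_delta_ge0 _))// ltNyr.
  by rewrite /gauge_delta (negbTE jD).
apply: le_ereal_inf_tmp => _ [U [AU dU ->]].
apply: ereal_inf_lbound; exists U.
  by split => // i; exact: sub_sigma_algebra.
by apply: eq_eseriesr => j _; rewrite /gauge_delta dU.
Qed.

Lemma content_ge0 A : 0 <= content A.
Proof. by rewrite contentE; exact: mu_ext_ge0. Qed.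

Lemma le_content A B : A `<=` B -> content A <= content B.
Proof. by move=> AB; rewrite !contentE; exact: (@le_mu_ext _ discreteR _ _ _ _ AB). Qed.

Lemma content_sigma_subadditive : sigma_subadditive content.
Proof.
by move=> F; rewrite contentE; under eq_eseriesr do rewrite contentE;
  exact: mu_ext_sigma_subadditive.
Qed.

Lemma content0 : content set0 = 0.
Proof.
rewrite contentE; apply: mu_ext0 => //.
rewrite /gauge_delta hausdorff_gauge0 ifT//.
by apply: diam_le.
Qed.

Lemma content_setU A B : content (A `|` B) <= content A + content B.
Proof.
rewrite -bigcup2E; apply: le_trans (content_sigma_subadditive _) _.
rewrite (@eseries_finite _ 2)//; last by move=> [|[|n]]//= _; rewrite content0.
  by rewrite !big_ord_recl big_ord0 adde0.
by move=> n; exact: content_ge0.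
Qed.

Lemma content_le A (r : R) : (0 <= r <= delta)%R -> diam A <= r%:E ->
  content A <= (r `^ s)%:E.
Proof.
move=> /andP[r0 rd] Ar.
apply: le_trans (hausdorff_gauge_le r0 Ar).
apply: ereal_inf_lbound; exists (bigcup2 A set0); split.
- by rewrite bigcup2E setU0.
- move=> [|[|j]] /=; first by apply: le_trans Ar _; rewrite lee_fin.
    by apply: diam_le.
  by apply: diam_le.
- rewrite (@eseries_finite _ 1)//.
  + by rewrite big_ord_recl big_ord0 adde0.
  + by move=> n; exact: hausdorff_gauge_ge0.
  + by move=> [|[|n]]//= _; rewrite hausdorff_gauge0.
Qed.

(** Each induction step peels off the last stretch of length delta, whose content is at most
    delta^s. *)
Lemma content_lty (a : R) (n : nat) A :
  (forall x, A x -> (a <= x <= a + n%:R * delta)%R) -> content A < +oo.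
Proof.
elim: n A => [|n IH] A Aan.
  apply: (@le_lt_trans _ _ (delta `^ s)%:E); last exact: ltry.
  apply: content_le; first by rewrite lexx ltW.
  apply: diam_le => x y /Aan + /Aan.
  by rewrite mul0r addr0 => /andP[? ?] /andP[? ?] _; have := ltW delta0; lra.
pose b := (a + n%:R * delta)%R.
have -> : A = (A `&` [set x | (x <= b)%R]) `|` (A `&` [set x | (b < x)%R]).
  rewrite -setIUr; apply/esym/setIidl => x _ /=.
  by have [|] := leP x b; [left|right].
apply: le_lt_trans (content_setU _ _) _; apply: lte_add_pinfty.
  by apply: IH => x [/Aan/andP[-> _]].
apply: (@le_lt_trans _ _ (delta `^ s)%:E); last exact: ltry.
apply: content_le; first by rewrite lexx ltW.
apply: diam_le => x y [_ /= bx] [/Aan/andP[_ +] _] _.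
rewrite -natr1 mulrDl mul1r addrA -/b; lra.
Qed.

Lemma content_bounded_lty A (N : R) : (forall x, A x -> (`|x| <= N)%R) ->
  content A < +oo.
Proof.
move=> AN; pose n := Num.truncn (2 * N / delta).
apply: (@content_lty (- N)%R n.+1) => x /AN; rewrite ler_norml => /andP[-> xN] /=.
have : (2 * N / delta <= n.+1%:R)%R by rewrite ltW// truncnS_gt.
by rewrite ler_pdivrMr//; lra.
Qed.

End hausdorff_content.

(* The distribution function of the content restricted to a bounded piece of [C]
   plays the role of a Frostman measure. *)
Lemma hausdorff_profile (R : realType) (s : R) (C : set R) : 0 < s ->
  (0 < hausdorff_measure s C)%E ->
  exists h : R -> R, exists K M N : R, [/\ [/\ 0 < K, 0 < M & 0 < N],
    {homo h : x y / x <= y},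
    forall x y, x <= y -> h y - h x <= K * (y - x) `^ s,
    forall x y, x <= y -> (forall t, x <= t <= y -> ~ C t) -> h x = h y &
    (forall x, x <= - N -> h x = 0) /\ (forall x, N <= x -> h x = M)].
Proof.
move=> s0 /ereal_sup_gt[_ [delta /= delta0 <-]].
set c := hausdorff_content s delta => cC.
pose D (n : nat) := C `&` [set x : R | `|x| <= n%:R].
(* By countable subadditivity, some bounded piece of C already has positive content. *)
have [n cn] : exists n : nat, (0 < c (D n))%E.
  apply/not_existsP => cn0.
  suff : (c C <= 0)%E by rewrite leNgt cC.
  have CE : C = \bigcup_n D n.
    apply/seteqP; split => [x Cx|x [n _ []]//].
    exists (Num.truncn `|x|).+1 => //; split => //=.
    by rewrite ltW// truncnS_gt.
  rewrite {1}CE; apply: le_trans (content_sigma_subadditive _ _ _) _.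
  rewrite eseries0// => n _ _; apply/eqP; rewrite eq_le content_ge0 andbT.
  by rewrite leNgt; apply/negP; exact: cn0.
(* A may contain -n itself; the extra 1 makes [B x] empty for all x <= -N. *)
pose N : R := n%:R + 1.
have N0 : 0 < N by rewrite ltr_wpDl.
pose A := D n.
pose B x := A `&` [set t | t <= x].
have BA x : B x `<=` A by move=> t [].
have Afin : (c A < +oo)%E.
  by apply: (@content_bounded_lty _ _ _ s0 delta0 _ n%:R) => x [].
have Bfin x : (c (B x)) \is a fin_num.
  rewrite ge0_fin_numE ?content_ge0//; apply: le_lt_trans Afin.
  exact: le_content.
pose h x := fine (c (B x)).
pose M := fine (c A).
have Afn : c A \is a fin_num by rewrite ge0_fin_numE ?content_ge0.
have M0 : 0 < M by rewrite fine_gt0// cn.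
have hM x : h x <= M by rewrite fine_le//; exact: le_content.
have h0 x : 0 <= h x by rewrite fine_ge0// content_ge0.
have hnd : {homo h : x y / x <= y}.
  move=> x y xy; rewrite fine_le//; apply: le_content => // t [? /= tx].
  by split => //=; exact: le_trans xy.
pose E x y := A `&` [set t | x < t <= y].
have hincr x y : x <= y ->
    ((h y)%:E <= (h x)%:E + c (E x y))%E.
  move=> xy; rewrite !fineK//.
  apply: le_trans (content_setU _ _ _ _) => //.
  apply: le_content => // t [At /= ty]; have [tx|xt] := leP t x.
    by left.
  by right; split => //=; rewrite xt.
(* For y - x <= delta the increment is at most (y - x)^s, by covering the piece between x and y by
   itself; for larger y - x it is at most M, hence at most (M / delta^s) (y - x)^s. The constant
   adds the two cases. *)
exists h, (1 + M / delta `^ s), M, N; split => //.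
- by split => //; rewrite ltr_wpDr// divr_ge0 ?powR_ge0// ltW.
- move=> x y xy; have [yxd|yxd] := leP (y - x) delta.
    have := hincr _ _ xy; have : (c (E x y) <= ((y - x) `^ s)%:E)%E.
      apply: content_le => //; first by rewrite subr_ge0 xy.
      apply: diam_le => u v [_ /= /andP[? ?]] [_ /= /andP[? ?]] _; lra.
    move=> le1 /le_trans /(_ (leeD2l _ le1)); rewrite -EFinD lee_fin.
    move=> hyx; apply: (@le_trans _ _ ((y - x) `^ s)); first lra.
    by rewrite ler_peMl ?powR_ge0// lerDl divr_ge0 ?powR_ge0// ltW.
  apply: (@le_trans _ _ (M / delta `^ s * (y - x) `^ s)).
    rewrite mulrAC ler_pdivlMr ?powR_gt0//.
    apply: (@le_trans _ _ (M * delta `^ s)).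
      by rewrite ler_wpM2r ?powR_ge0//; have := hM y; have := h0 x; lra.
    rewrite ler_wpM2l ?(ltW M0)//; apply: ge0_ler_powR; rewrite ?nnegrE ltW//.
    by rewrite (lt_trans delta0).
  by rewrite ler_wpM2r ?powR_ge0// lerDr.
- move=> x y xy Cxy; congr (fine (c _)).
  apply/seteqP; split => t [At /= tx]; split => //=; first exact: le_trans xy.
  rewrite leNgt; apply/negP => xt; apply: (Cxy t); last by case: At.
  by rewrite (ltW xt).
- split => x Nx; rewrite /h.
    rewrite (_ : B x = set0) ?/c ?content0//.
    apply/seteqP; split => // t [[_ /=]]; rewrite ler_norml => /andP[? _] ?.
    by move: Nx; rewrite /N; lra.
  congr (fine (c _)); apply/setIidl => t [_ /=].
  by rewrite ler_norml => /andP[_ ?]; move: Nx; rewrite /N; lra.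
Qed.

(** If F were null, it would have covers by half-open intervals of total length below min(e, delta).
    Each interval is then shorter than delta, so the cover is admissible for the content at scale
    delta, which is therefore at most e. *)
Lemma hausdorff_measure1_gt0 (R : realType) (F : set R) :
  (0 < hausdorff_measure 1 F)%E -> (0 < lebesgue_measure F)%E.
Proof.
move=> /ereal_sup_gt[_ [delta /= delta0 <-] cF]; rewrite lt0e measure_ge0 andbT.
apply/eqP => F0; move: cF; apply/negP; rewrite -leNgt.
apply/lee_addgt0Pr => e e0; rewrite add0e.
pose r := Num.min e delta.
have r0 : 0 < r by rewrite lt_min e0.
have : (lebesgue_measure F < r%:E)%E by rewrite F0 lte_fin.
rewrite /lebesgue_measure/= /lebesgue_stieltjes_measure/= /measure_extension/=.
move=> /ereal_inf_lt[_ [A [mA FA] <-] Ar].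
have w0 j : (0 <= wlength idfun (A j))%E by exact: wlength_ge0.
have wr j : (wlength idfun (A j) <= r%:E)%E.
  apply: le_trans (ltW Ar).
  apply: le_trans (nneseries_lim_ge j.+1 _) => //.
  by rewrite big_mkord big_ord_recr/= leeDr// sume_ge0.
have dA j : (diam (A j) <= wlength idfun (A j))%E.
  have /ocitvP[->|[[a b] /= ab ->]] := mA j.
    by rewrite wlength0; apply: diam_le.
  rewrite wlength_itv/= lte_fin ab -EFinD; apply: diam_le => x y /=.
  by rewrite !in_itv/= => /andP[? ?] /andP[? ?] _; lra.
apply: (@le_trans _ _ r%:E); last by rewrite lee_fin ge_min lexx.
apply: le_trans (ltW Ar).
apply: (@le_trans _ _ (\sum_(j <oo) hausdorff_gauge 1%R (A j))%E).
  apply: ereal_inf_lbound; exists A; split => // j.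
  rewrite (le_trans (dA j))// (le_trans (wr j))// lee_fin.
  by rewrite ge_min lexx orbT.
apply: lee_nneseries => [j *|j *]; first exact: hausdorff_gauge_ge0.
have wfin : wlength idfun (A j) \is a fin_num.
  by rewrite ge0_fin_numE// (le_lt_trans (wr j))// ltry.
rewrite -[leRHS]fineK// -[X in (_ <= X%:E)%E]powRr1 ?fine_ge0//.
apply: hausdorff_gauge_le; rewrite ?fine_ge0//.
by rewrite fineK.
Qed.

(** * The gaps of F *)

Section gaps.
Variable R : realType.
Implicit Types (F : set R) (y t : R).

Lemma closed_sup F : closed F -> F !=set0 -> has_ubound F -> F (sup F).
Proof. by move=> cF F0 uF; rewrite [F in F (sup _)](closure_id F).1//; exact: closure_sup. Qed.

Lemma closed_inf F : closed F -> F !=set0 -> has_lbound F -> F (inf F).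
Proof.
move=> cF F0 lF; rewrite [F in F (inf _)](closure_id F).1// => B.
move=> /nbhs_ballP[e /= e0 eB].
have [x Fx xe] := inf_adherent e0 (conj F0 lF).
exists x; split => //; apply: eB; rewrite /ball/=.
by have := ge_inf lF Fx => ?; rewrite ler0_norm; lra.
Qed.

Definition gap_left F y := sup (F `&` [set t | t <= y]).
Definition gap_right F y := inf (F `&` [set t | y <= t]).
(** Half the harmonic mean of the distances from y to the two ends of its gap. It lies between half
    their minimum and their minimum, like the distance to F, but has no corner at the middle of the
    gap. It is meaningful only for y in a gap. *)
Definition gap_dist F y :=
  (y - gap_left F y) * (gap_right F y - y) / (gap_right F y - gap_left F y).

Variables (F : set R) (a b : R).
Hypotheses (cF : closed F) (Fa : F a) (Fb : F b).

Definition gap_set := `]a, b[ `\` F.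

Lemma open_gap_set : open gap_set.
Proof.
rewrite /gap_set setDE; apply: openI; last exact: closed_openC.
exact: interval_open.
Qed.

Notation l := (gap_left F).
Notation r := (gap_right F).
Notation d := (gap_dist F).

Lemma gap_leftP y : gap_set y ->
  [/\ F (l y), l y < y & forall t, F t -> t <= y -> t <= l y].
Proof.
rewrite /gap_set => -[/=]; rewrite in_itv/= => /andP[ay yb] nFy.
have ub : has_ubound (F `&` [set t | t <= y]) by exists y => t [].
have [Fl ly] : (F `&` [set t | t <= y]) (l y).
  apply: closed_sup => //; last by exists a; split => //=; exact: ltW.
  by apply: closedI => //; exact: closed_le.
split => // [|t Ft ty]; last by apply: ub_le_sup.
by rewrite lt_neqAle ly andbT; apply: contra_notN nFy => /eqP <-.
Qed.

Lemma gap_rightP y : gap_set y ->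
  [/\ F (r y), y < r y & forall t, F t -> y <= t -> r y <= t].
Proof.
rewrite /gap_set => -[/=]; rewrite in_itv/= => /andP[ay yb] nFy.
have lb : has_lbound (F `&` [set t | y <= t]) by exists y => t [].
have [Fr ry] : (F `&` [set t | y <= t]) (r y).
  apply: closed_inf => //; last by exists b; split => //=; exact: ltW.
  by apply: closedI => //; exact: closed_ge.
split => // [|t Ft ty]; last by apply: ge_inf.
by rewrite lt_neqAle ry andbT; apply: contra_notN nFy => /eqP ->.
Qed.

Lemma gap_mem y t : gap_set y -> l y < t < r y -> gap_set t.
Proof.
move=> Gy /andP[lt tr]; have [_ ly lmax] := gap_leftP Gy.
have [_ yr rmin] := gap_rightP Gy.
have [/= + nFy] := Gy; rewrite in_itv/= => /andP[ay yb].
split => /=.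
  rewrite in_itv/=; have := lmax _ Fa (ltW ay); have := rmin _ Fb (ltW yb).
  by move=> ? ?; apply/andP; split; lra.
move=> Ft; have [ty|yt] := leP t y.
  by have := lmax _ Ft ty; rewrite leNgt lt.
by have := rmin _ Ft (ltW yt); rewrite leNgt tr.
Qed.

(** Hence [gap_dist] is a fixed quadratic polynomial near each point of a gap, and can be
    differentiated there. *)
Lemma gap_const y t : gap_set y -> l y < t < r y -> l t = l y /\ r t = r y.
Proof.
move=> Gy ltr; have Gt := gap_mem Gy ltr; have /andP[lt tr] := ltr.
have [Fl ly lmax] := gap_leftP Gy; have [Fr yr rmin] := gap_rightP Gy.
have [Flt lt_lt ltmax] := gap_leftP Gt; have [Frt trt rtmin] := gap_rightP Gt.
split; apply/eqP; rewrite eq_le; apply/andP; split.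
- by rewrite leNgt; apply/negP => h; case: (@gap_mem y (l t) Gy) => //; rewrite h/=; lra.
- by apply: ltmax => //; exact: ltW.
- by apply: rtmin => //; exact: ltW.
- by rewrite leNgt; apply/negP => h; case: (@gap_mem y (r t) Gy) => //; rewrite h andbT; lra.
Qed.

Lemma near_gap y : gap_set y -> \forall t \near y, l y < t < r y.
Proof.
move=> Gy; have [_ ly _] := gap_leftP Gy; have [_ yr _] := gap_rightP Gy.
near=> t; apply/andP; split; near: t; [exact: lt_nbhsr|exact: lt_nbhsl].
Unshelve. all: by end_near. Qed.

Lemma gap_dist_gt0 y : gap_set y -> 0 < d y.
Proof.
move=> Gy; have [_ ly _] := gap_leftP Gy; have [_ yr _] := gap_rightP Gy.
by rewrite /d divr_gt0 ?mulr_gt0// subr_gt0//; lra.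
Qed.

Lemma gap_dist_le y t : gap_set y -> F t -> d y <= `|y - t|.
Proof.
move=> Gy Ft; have [_ ly lmax] := gap_leftP Gy.
have [_ yr rmin] := gap_rightP Gy.
rewrite /gap_dist ler_pdivrMr; last lra.
have [ty|yt] := leP t y.
  have := lmax _ Ft ty => ?; rewrite ger0_norm; last lra.
  nra.
have := rmin _ Ft (ltW yt) => ?; rewrite ltr0_norm; last lra.
nra.
Qed.

Lemma gap_dist_le_width y : gap_set y -> d y <= b - a.
Proof.
move=> Gy; apply: le_trans (gap_dist_le Gy Fa) _.
have [/= + _] := Gy; rewrite in_itv/= => /andP[? ?].
by rewrite ger0_norm; lra.
Qed.

Lemma gap_dist_ge y : gap_set y -> Num.min (y - l y) (r y - y) / 2 <= d y.
Proof.
move=> Gy; have [_ ly _] := gap_leftP Gy; have [_ yr _] := gap_rightP Gy.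
rewrite /gap_dist ler_pdivlMr; last lra.
by rewrite minEle; case: ifPn => [?|]; rewrite -?ltNge; nra.
Qed.

Definition gap_dist' y := (l y + r y - y *+ 2) / (r y - l y).

Lemma is_derive_gap_dist y : gap_set y -> is_derive y 1 d (gap_dist' y).
Proof.
move=> Gy; have [_ ly _] := gap_leftP Gy; have [_ yr _] := gap_rightP Gy.
have h : is_derive y 1 (fun t => (t - l y) * (r y - t) / (r y - l y))
    (gap_dist' y).
  have d1 := is_derive_subf (is_derive_id y 1) (is_derive_cst (l y) y 1).
  have d2 := is_derive_subf (is_derive_cst (r y) y 1) (is_derive_id y 1).
  have := is_derive_mulf (is_derive_mulf d1 d2)
    (is_derive_cst (r y - l y)^-1 y 1).
  move=> /is_derive_eq; apply; rewrite /gap_dist' /cst/=; field.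
  by rewrite gt_eqF// subr_gt0; lra.
apply: near_eq_is_derive h.
apply: filterS (near_gap Gy) => t /(gap_const Gy)[lt rt].
by rewrite /gap_dist lt rt.
Qed.

Lemma continuous_gap_dist' y : gap_set y -> {for y, continuous gap_dist'}.
Proof.
move=> Gy.
have h : {for y, continuous (fun t => (l y + r y - t *+ 2) / (r y - l y))}.
  apply: cvgM; last exact: cvg_cst.
  by apply: cvgB; [exact: cvg_cst|apply: cvgMn; exact: cvg_id].
apply: near_eq_continuous_at h.
apply: filterS (near_gap Gy) => t /(gap_const Gy)[lt rt].
by rewrite /gap_dist' lt rt.
Qed.

Lemma gap_dist'_le1 y : gap_set y -> `|gap_dist' y| <= 1.
Proof.
move=> Gy; have [_ ly _] := gap_leftP Gy; have [_ yr _] := gap_rightP Gy.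
rewrite /gap_dist' ler_norml ler_pdivlMr ?ler_pdivrMr; [|lra..].
by rewrite mulr2n; apply/andP; split; lra.
Qed.

End gaps.

(** * Integrability of powers of the gap distance *)

Section singular_integral.
Variable R : realType.
Notation mu := (@lebesgue_measure R).
Variables (c d beta : R).
Hypotheses (cd : c < d) (beta1 : beta < 1).

Let f y := (y - c) `^ (- beta) + (d - y) `^ (- beta).
Let G y := ((y - c) `^ (1 - beta) - (d - y) `^ (1 - beta)) / (1 - beta).

Let is_derive_shift e y : c < y < d ->
  is_derive y 1 (fun t => (t - c) `^ e) (e * (y - c) `^ (e - 1)) /\
  is_derive y 1 (fun t => (d - t) `^ e) (- (e * (d - y) `^ (e - 1))).
Proof.
move=> /andP[cy yd]; split.
  have d1 := is_derive_subf (is_derive_id y 1) (is_derive_cst c y 1).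
  have := is_derive_compf (f := fun t : R => t `^ e) (g := fun t => t - c) (x := y)
    (@is_derive1_powR R e (y - c) ltac:(by rewrite subr_gt0)) d1.
  by move=> /is_derive_eq; apply; rewrite subr0 mulr1.
have d2 := is_derive_subf (is_derive_cst d y 1) (is_derive_id y 1).
have := is_derive_compf (f := fun t : R => t `^ e) (g := fun t => d - t) (x := y)
  (@is_derive1_powR R e (d - y) ltac:(by rewrite subr_gt0)) d2.
by move=> /is_derive_eq; apply; rewrite sub0r mulrN1.
Qed.

Lemma continuous_singular y : c < y < d -> {for y, continuous f}.
Proof.
move=> /(is_derive_shift (- beta))[h1 h2].
by apply: cvgD; [exact: is_derive_continuous h1|exact: is_derive_continuous h2].
Qed.

(** [G] is an antiderivative on the open interval. On closed subintervals its increment involves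
    four powers, each between 0 and (d - c)^(1 - beta), two of them with a minus sign; monotone
    convergence then exhausts the interval. *)
Lemma singular_integral_le :
  (\int[mu]_(y in `]c, d[) (f y)%:E <=
   (2 * (d - c) `^ (1 - beta) / (1 - beta))%:E)%E.
Proof.
have f0 y : 0 <= f y by rewrite addr_ge0// powR_ge0.
have dG y : c < y < d -> is_derive y 1 G (f y).
  move=> /(is_derive_shift (1 - beta))[h1 h2].
  have := is_derive_mulf (is_derive_subf h1 h2)
    (is_derive_cst (1 - beta)^-1 y 1).
  move=> /is_derive_eq; apply; rewrite /cst/= mulr0 addr0 opprK -mulrDr.
  rewrite mulrAC mulfV ?mul1r; last by rewrite subr_eq0 gt_eqF.
  by rewrite addrAC subrr add0r.
(* The 3 keeps the step below half the length for every n, so that no [F n] is degenerate. *)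
pose step (n : nat) := (d - c) / n.+3%:R.
pose F (n : nat) : set R := `[c + step n, d - step n]%classic.
have step0 n : 0 < step n by rewrite divr_gt0// subr_gt0.
have step_lt n : step n < (d - c) / 2.
  by rewrite ltr_pM2l ?subr_gt0// ltf_pV2 ?posrE// ltr_nat.
have FE : `]c, d[%classic = \bigcup_n F n.
  apply/seteqP; split => [y|y [n _]] /=; rewrite in_itv/=; last first.
    by rewrite /F/= in_itv/= => /andP[? ?]; have := step0 n => ?; apply/andP; split; lra.
  move=> /andP[cy yd].
  pose m := Num.min (y - c) (d - y).
  have m0 : 0 < m by rewrite lt_min !subr_gt0 cy.
  pose n := Num.truncn ((d - c) / m).
  exists n => //; rewrite /F/= in_itv/=.
  have sm : step n <= m.
    rewrite ler_pdivrMr// mulrC -ler_pdivrMr//.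
    apply: (@le_trans _ _ n.+1%:R); first by rewrite ltW// truncnS_gt.
    by rewrite ler_nat ltnW// ltnW.
  move: sm; rewrite le_min => /andP[? ?]; apply/andP; split; lra.
have cf n : {within F n, continuous f}.
  apply: continuous_in_subspaceT => y /set_mem; rewrite /F/= in_itv/= => /andP[? ?].
  by apply: continuous_singular; have := step0 n => ?; apply/andP; split; lra.
have cv : (\int[mu]_(y in F n) (f y)%:E @[n --> \oo] -->
    \int[mu]_(y in \bigcup_n F n) (f y)%:E)%E.
  apply: ge0_nondecreasing_set_cvg_integral.
  - apply/nondecreasing_seqP => n; apply/subsetPset => y; rewrite /F/= !in_itv/=.
    have : step n.+1 <= step n.
      by rewrite ler_pM2l ?subr_gt0// lef_pV2 ?posrE// ler_nat.
    by move=> ? /andP[? ?]; apply/andP; split; lra.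
  - by move=> n; exact: measurable_itv.
  - move=> n; apply/measurable_EFinP; apply: subspace_continuous_measurable_fun => //.
    exact: measurable_itv.
  - by move=> n y _; rewrite lee_fin.
rewrite FE -(cvg_lim _ cv)//; apply: lime_le; first by apply: cvgP; exact: cv.
near=> n.
have b1 : 0 < 1 - beta by rewrite subr_gt0.
have sn := step_lt n; have s0 := step0 n.
rewrite (@continuous_FTC2 _ f G)//.
- rewrite -EFinB lee_fin /G -mulrBl ler_pM2r ?invr_gt0//.
  set X := (d - c) `^ _.
  have pX t : 0 <= t -> t <= d - c -> 0 <= t `^ (1 - beta) <= X.
    by move=> t0 tX; rewrite powR_ge0/= ge0_ler_powR ?nnegrE ?(ltW b1)//; lra.
  have /andP[? ?] := pX (d - step n - c) ltac:(lra) ltac:(lra).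
  have /andP[? ?] := pX (d - (d - step n)) ltac:(lra) ltac:(lra).
  have /andP[? ?] := pX (c + step n - c) ltac:(lra) ltac:(lra).
  have /andP[? ?] := pX (d - (c + step n)) ltac:(lra) ltac:(lra).
  lra.
- lra.
- exact: (cf n).
- split.
  + move=> y; rewrite in_itv/= => /andP[? ?].
    by case: (dG y) => //; apply/andP; split; lra.
  + by apply: cvg_at_right_filter; apply: is_derive_continuous (dG _ _); apply/andP; split; lra.
  + by apply: cvg_at_left_filter; apply: is_derive_continuous (dG _ _); apply/andP; split; lra.
- move=> y; rewrite in_itv/= => /andP[? ?]; rewrite derive1E.
  by case: (dG y) => //; apply/andP; split; lra.
Unshelve. all: by end_near. Qed.

End singular_integral.

Section gap_integral.
Variable R : realType.
Notation mu := (@lebesgue_measure R).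
Variables (F : set R) (a b beta : R) (I : nat -> set R).
Hypotheses (cF : closed F) (Fa : F a) (Fb : F b) (ab1 : b - a <= 1).
Hypotheses (oI : forall j, open (I j)) (itvI : forall j, is_interval (I j)).
Hypothesis IF0 : forall j t, I j t -> ~ F t.
Hypothesis coverI : gap_set F a b `<=` \bigcup_j I j.
Hypothesis beta1 : beta < 1.
Hypothesis sumI : (\sum_(j <oo) mu (I j) `^ (1 - beta)%R < +oo)%E.
Notation G := (gap_set F a b).
Notation d := (gap_dist F).

Let oG : open G. Proof. exact: open_gap_set. Qed.
Let mG : measurable G. Proof. exact: open_measurable. Qed.

Lemma continuous_gap_dist y : G y -> {for y, continuous d}.
Proof. by move=> Gy; exact: is_derive_continuous (is_derive_gap_dist cF Fa Fb Gy). Qed.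

Let meas : measurable_fun G (fun y => (d y `^ (- beta))%:E).
Proof.
apply/measurable_EFinP.
apply: (measurableT_comp (f := fun t : R => t `^ (- beta))).
  exact: measurable_powR.
apply: open_continuous_measurable_fun => // y /set_mem; exact: continuous_gap_dist.
Qed.

Let c j := inf (I j).
Let e j := sup (I j).

(* An interval [I j] meeting [G] lies in a single gap, hence is bounded, and
   the gap is at least as wide, so that [d] is at least half the distance to the
   ends of [I j]. *)
Let I_bounded j y : G y -> I j y -> [/\ I j = `]c j, e j[%classic,
  gap_left F y <= c j, e j <= gap_right F y & c j < y < e j].
Proof.
move=> Gy Ijy; have [Fl ly _] := gap_leftP cF Fa Gy.
have [Fr yr _] := gap_rightP cF Fb Gy.
have lI t : I j t -> gap_left F y <= t.
  move=> It; rewrite leNgt; apply/negP => tl; apply: (@IF0 j _ _ Fl).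
  by apply: (itvI It Ijy); rewrite (ltW tl) (ltW ly).
have rI t : I j t -> t <= gap_right F y.
  move=> It; rewrite leNgt; apply/negP => tl; apply: (@IF0 j _ _ Fr).
  by apply: (itvI Ijy It); rewrite (ltW tl) (ltW yr).
have hl : has_lbound (I j) by exists (gap_left F y).
have hr : has_ubound (I j) by exists (gap_right F y).
have IE : I j = `]c j, e j[%classic.
  have := interval_bounded_interior (@itvI j) hl hr.
  move: (@oI j); rewrite interior_id => ->.
  by rewrite set_itvoo.
split => //.
- by apply: lb_le_inf => //; exists y.
- by apply: ge_sup => //; exists y.
- by move: Ijy; rewrite IE/= in_itv.
Qed.

(** For beta > 0 this dominates d^(-beta) on the part of [I j] in the gaps. Nothing is known about
    the ends of the intervals that miss the gaps, so these contribute 0. *)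
Let g j : R -> R :=
  if `[< I j `&` G !=set0 >] then fun y => 2 `^ beta *
    (((fun y => (y - c j) `^ (- beta) + (e j - y) `^ (- beta)) \_ `]c j, e j[) y)
  else cst 0.

Let g_ge0 j y : 0 <= g j y.
Proof.
rewrite /g; case: ifP => // _; rewrite mulr_ge0 ?powR_ge0// patchE.
by case: ifP => // _; rewrite addr_ge0 ?powR_ge0.
Qed.

Let meas_singular (u v : R) : measurable_fun setT
  ((fun y => (y - u) `^ (- beta) + (v - y) `^ (- beta)) \_ `]u, v[).
Proof.
apply: (measurable_restrictT _ (measurable_itv _)).1.
apply: open_continuous_measurable_fun; first exact: interval_open.
by move=> y /set_mem/=; rewrite in_itv/=; exact: continuous_singular.
Qed.

Let g_meas j : measurable_fun setT (g j).
Proof.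
by rewrite /g; case: ifP => // _; exact: measurable_funM.
Qed.

Let g_int j : (\int[mu]_y (g j y)%:E <=
  (2 `^ beta * 2 / (1 - beta))%:E * mu (I j) `^ (1 - beta)%R)%E.
Proof.
have k0 : 0 <= 2 `^ beta * 2 / (1 - beta).
  by rewrite divr_ge0 ?mulr_ge0 ?powR_ge0// subr_ge0 ltW.
rewrite /g; case: asboolP => [[y [Ijy Gy]]|_]; last first.
  apply: (@le_trans _ _ 0%E); first by rewrite (_ : integral _ _ _ = 0%E)//; exact: integral0_eq.
  by apply: mule_ge0; rewrite ?lee_fin// poweR_ge0.
have [IE _ _ /andP[cy ye]] := I_bounded Gy Ijy.
have ce := lt_trans cy ye.
under eq_integral do rewrite EFinM.
rewrite ge0_integralZl//; last 2 first.
- by apply/measurable_EFinP; exact: (meas_singular (c j) (e j)).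
- move=> t _; rewrite lee_fin patchE.
  by case: ifP => // _; rewrite addr_ge0 ?powR_ge0.
pose f := fun t => (t - c j) `^ (- beta) + (e j - t) `^ (- beta).
have -> : (\int[mu]_t ((f \_ `]c j, e j[) t)%:E =
    \int[mu]_(t in `]c j, e j[) (f t)%:E)%E.
  rewrite [RHS]integral_mkcond; apply: eq_integral => t _.
  by rewrite !patchE; case: ifP.
apply: (@le_trans _ _ ((2 `^ beta)%:E *
    (2 * (e j - c j) `^ (1 - beta) / (1 - beta))%:E)%E).
  by rewrite lee_wpmul2l ?lee_fin ?powR_ge0//; exact: singular_integral_le.
rewrite IE lebesgue_measure_itv/= lte_fin ce -EFinD poweR_EFin -!EFinM lee_fin.
by rewrite le_eqVlt; apply/orP; left; apply/eqP; ring.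
Qed.

(** For beta <= 0 the integrand is at most 1, since d <= b - a <= 1. For 0 < beta < 1, d is at least
    half the smaller distance to the ends of [I j], and the resulting bound [g j] integrates to a
    multiple of |I j|^(1 - beta). The intervals may overlap: the sum of all [g j] is still an upper
    bound. *)
Lemma gap_integral_lty : (\int[mu]_(y in G) (d y `^ (- beta))%:E < +oo)%E.
Proof.
have [b0|b0] := leP beta 0.
  apply: (@le_lt_trans _ _ (\int[mu]_(y in G) 1%:E)%E).
    apply: ge0_le_integral => //.
    - by move=> y _; rewrite lee_fin powR_ge0.
    - move=> y Gy; rewrite lee_fin (_ : 1 = 1 `^ (- beta) :> R); last by rewrite powR1.
      have d0 := gap_dist_gt0 cF Fa Fb Gy.
      have d1 := le_trans (gap_dist_le_width cF Fa Fb Gy) ab1.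
      by apply: ge0_ler_powR; rewrite ?nnegrE ?oppr_ge0 ?(ltW d0).
  rewrite integral_cst// mul1e; apply: (@le_lt_trans _ _ (mu `]a, b[)).
    by apply: le_measure; rewrite ?inE//; exact: subIsetl.
  by rewrite lebesgue_measure_itv/=; case: ifPn => _; rewrite ltry.
apply: (@le_lt_trans _ _ (\int[mu]_y (\sum_(j <oo) (g j y)%:E))%E).
  rewrite integral_mkcond; apply: ge0_le_integral => //.
  - by move=> y _; rewrite patchE; case: ifP => // _; rewrite lee_fin powR_ge0.
  - exact/(measurable_restrictT _ mG).
  - apply: ge0_emeasurable_sum => [n y _ _|n _]; first by rewrite lee_fin.
    by apply/measurable_EFinP; exact: g_meas.
  move=> y _; rewrite patchE; case: ifPn => [/set_mem Gy|_]; last first.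
    by apply: nneseries_ge0 => n _ _; rewrite lee_fin.
  have [j _ Ijy] := coverI Gy.
  apply: (@le_trans _ _ (g j y)%:E); last first.
    apply: le_trans (nneseries_lim_ge j.+1 _) => //.
      by rewrite big_mkord big_ord_recr/= leeDr// sume_ge0// => i _; rewrite lee_fin.
    by move=> n _ _; rewrite lee_fin.
  have [IE lc er cye] := I_bounded Gy Ijy; have /andP[cy ye] := cye.
  rewrite lee_fin /g asboolT; last by exists y.
  rewrite patchE mem_set/= ?in_itv/= ?cye//.
  have d0 := gap_dist_gt0 cF Fa Fb Gy.
  have := gap_dist_ge cF Fa Fb Gy.
  have pw t : 0 < t -> t / 2 <= d y -> d y `^ (- beta) <= 2 `^ beta * t `^ (- beta).
    move=> t0 td; rewrite !powRN ler_pdivlMr ?powR_gt0// mulrC ler_pdivrMr ?powR_gt0//.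
    rewrite -powRM ?(ltW d0)//; apply: ge0_ler_powR; rewrite ?nnegrE ?(ltW b0) ?(ltW t0)//.
      by rewrite mulr_ge0// ltW.
    by rewrite mulrC -ler_pdivrMr.
  rewrite minEle; case: ifPn => _ hd.
    apply: (@le_trans _ _ (2 `^ beta * (y - c j) `^ (- beta))).
      by apply: pw; lra.
    by rewrite ler_wpM2l ?powR_ge0// lerDl powR_ge0.
  apply: (@le_trans _ _ (2 `^ beta * (e j - y) `^ (- beta))).
    by apply: pw; lra.
  by rewrite ler_wpM2l ?powR_ge0// lerDr powR_ge0.
rewrite integral_nneseries//; last 2 first.
- by move=> n; apply/measurable_EFinP; exact: g_meas.
- by move=> n y _; rewrite lee_fin.
set k := 2 `^ beta * 2 / (1 - beta).
apply: (@le_lt_trans _ _ (\sum_(j <oo) (k%:E * mu (I j) `^ (1 - beta)%R))%E).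
  apply: lee_nneseries => // n *; apply: integral_ge0 => y _.
  by rewrite lee_fin.
rewrite nneseriesZl; last by move=> i _; exact: poweR_ge0.
apply: lte_mul_pinfty => //; rewrite lee_fin.
by rewrite divr_ge0 ?mulr_ge0 ?powR_ge0// subr_ge0 ltW.
Qed.

End gap_integral.

(** * Antiderivatives and the tent profile *)

Lemma antiderivative (R : realType) (f : R -> R) (N : R) : continuous f ->
  (forall x, x <= N -> f x = 0) -> exists F : R -> R, forall x : R, is_derive x 1 F (f x).
Proof.
move=> cf f0; pose mu := @lebesgue_measure R.
have intf u : mu.-integrable `]-oo, u] (EFin \o f).
  have mN : measurable (`[N, Num.max N u] : set (measurableTypeR R)).
    exact: measurable_itv.
  have mu' : measurable (`]-oo, u] : set (measurableTypeR R)).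
    exact: measurable_itv.
  have i0 : mu.-integrable `[N, Num.max N u] (EFin \o f).
    apply: continuous_compact_integrable; first exact: segment_compact.
    exact: continuous_subspaceT.
  have i1 := (integrable_mkcond _ mN).1 i0.
  have := integrableS measurableT mu' (@subsetT _ _) i1.
  apply: eq_integrable => // x.
  rewrite inE/= in_itv/= => xu; rewrite patchE.
  case: ifPn => //; rewrite notin_setE/= in_itv/= => /negP.
  rewrite negb_and -!ltNge => /orP[xN|]; first by rewrite f0// ltW.
  by rewrite gt_max => /andP[_]; rewrite ltNge xu.
exists (fun x => \int[mu]_(t in `]-oo, x]) f t).
move=> x; have xx : x < x + 1 by lra.
have [dF F'] := @continuous_FTC1 _ f -oo%O x _ xx (intf _) (ltNyr x) (cf x).
by apply: DeriveDef; [exact: dF|rewrite -derive1E].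
Qed.

Lemma mean_value (R : realType) (F f : R -> R) (x t : R) : 0 < t ->
  (forall x : R, is_derive x 1 F (f x)) ->
  exists2 c, x <= c <= x + t & F (x + t) - F x = f c * t.
Proof.
move=> t0 dF; have xt : x < x + t by lra.
have [|c] := @MVT R F f x (x + t) xt.
  by apply: continuous_subspaceT => y; exact: is_derive_continuous (dF y).
rewrite in_itv/= => /andP[? ?] ->; exists c; first by rewrite !ltW.
by rewrite [x + t]addrC addrK.
Qed.

(* [k] is the tent function min(h, M - h), which has compact support while its
   oscillation is still controlled by that of [h]. *)
Lemma tent_profile (R : realType) (s : R) (C : set R) : 0 < s ->
  (0 < hausdorff_measure s C)%E ->
  exists h k : R -> R, exists K M N : R, [/\
    [/\ 0 < K, 0 < M, 0 < N & exists x, k x != 0],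
    [/\ {homo h : x y / x <= y}, forall x, 0 <= h x <= M, continuous h,
      (forall x y, x <= y -> h y - h x <= K * (y - x) `^ s) &
      exists H : R -> R, forall x : R, is_derive x 1 H (h x)] &
    [/\ forall x, 0 <= k x <= M, continuous k, forall x, N <= `|x| -> k x = 0,
      (forall x y, x <= y -> `|k y - k x| <= h y - h x) /\
      (forall x y, x <= y -> (forall t, x <= t <= y -> ~ C t) -> k x = k y) &
      exists K1 : R -> R, forall x : R, is_derive x 1 K1 (k x)]].
Proof.
move=> s0 /(hausdorff_profile s0)[h [K [M [N [[K0 M0 N0] hnd hK hC [hl hr]]]]]].
have hM x : 0 <= h x <= M.
  apply/andP; split.
    have <- : h (Num.min x (- N)) = 0 by apply: hl; rewrite ge_min lexx orbT.
    by apply: hnd; rewrite ge_min lexx.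
  have <- : h (Num.max x N) = M by apply: hr; rewrite le_max lexx orbT.
  by apply: hnd; rewrite le_max lexx.
have hK' x y : `|h x - h y| <= K * `|x - y| `^ s.
  have [xy|/ltW yx] := leP x y.
    have := hnd _ _ xy; have := hK _ _ xy => ? ?.
    by rewrite distrC [`|x - y|]distrC !ger0_norm ?subr_ge0.
  have := hnd _ _ yx; have := hK _ _ yx => ? ?.
  by rewrite !ger0_norm ?subr_ge0.
have ch : continuous h.
  move=> x; apply/cvgrPdist_le => e e0.
  pose r := (e / K) `^ s^-1.
  have r0 : 0 < r by rewrite powR_gt0// divr_gt0.
  exists r => //= y /ltW xy; apply: le_trans (hK' _ _) _.
  rewrite mulrC -ler_pdivlMr//.
  have -> : e / K = r `^ s.
    by rewrite /r -powRrM mulVf ?gt_eqF// powRr1// ltW// divr_gt0.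
  by apply: ge0_ler_powR; rewrite ?nnegrE ?(ltW s0) ?(ltW r0).
pose k x := Num.min (h x) (M - h x).
have kE x : k x = Num.min (h x) (M - h x) by [].
have kM x : 0 <= k x <= M.
  have /andP[? ?] := hM x; rewrite kE le_min ge_min.
  by apply/andP; split; [apply/andP; split; lra|apply/orP; left].
have ck : continuous k.
  move=> x; have cMh : {for x, continuous (fun t => M - h t)}.
    by apply: cvgB; [exact: cvg_cst|exact: ch].
  exact: (@continuous_min _ _ h (fun t => M - h t) x (ch x) cMh).
have kN x : N <= `|x| -> k x = 0.
  rewrite kE minEle; case: (lerP 0 x) => [x0|x0].
    by rewrite ger0_norm// => /hr ->; rewrite subrr leNgt M0.
  rewrite ltr0_norm// => Nx; rewrite hl; last lra.
  by rewrite subr0 (ltW M0).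
exists h, k, K, M, N; split.
- split => //.
  (* At the midlevel h = M / 2, reached by continuity, the tent has its peak M / 2. *)
  have [x _ hx] : exists2 x, x \in `[- N, N] & h x = M / 2.
    apply: IVT; first lra.
      exact: continuous_subspaceT.
    rewrite hl// hr// minEle maxEle (ltW M0).
    by apply/andP; split; lra.
  exists x; rewrite kE hx minEle; case: ifP => _; lra.
- split => //; apply: (@antiderivative _ _ (- N)) => // x; exact: hl.
- split => //.
    split => x y xy; last by move=> Cxy; rewrite !kE (hC _ _ xy Cxy).
    have := hnd _ _ xy => ?.
    rewrite !kE !minEle ler_norml.
    by case: ifPn; case: ifPn; rewrite -?ltNge => ? ?; apply/andP; split; lra.
  apply: (@antiderivative _ _ (- N)) => // x xN; apply: kN.
  by rewrite ler0_norm; lra.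
Qed.

(** * The Sobolev function *)

Section average.
Variable R : realType.
Variables (h k K1 : R -> R) (M N : R).
Hypotheses (hnd : {homo h : x y / x <= y}).
Hypothesis kM : forall x, 0 <= k x <= M.
Hypothesis kN : forall x, N <= `|x| -> k x = 0.
Hypothesis kh : forall x y, x <= y -> `|k y - k x| <= h y - h x.
Hypothesis dK1 : forall x : R, is_derive x 1 K1 (k x).

Definition average x t := (K1 (x + t) - K1 x) / t.

(** Being a value of k inside the window, the average inherits the bounds, the oscillation estimate,
    the support and the local constancy of k. *)
Lemma average_mean x t : 0 < t ->
  exists2 c, x <= c <= x + t & average x t = k c.
Proof.
move=> t0; have [c xc e] := mean_value x t0 dK1; exists c => //.
by rewrite /average e mulfK// gt_eqF.
Qed.

Lemma average_le x t : 0 < t -> 0 <= average x t <= M.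
Proof. by move=> /(average_mean x)[c _ ->]. Qed.

Lemma average_osc x t : 0 < t -> `|k (x + t) - average x t| <= h (x + t) - h x.
Proof.
move=> /(average_mean x)[c /andP[xc cx] ->].
by apply: le_trans (kh cx) _; rewrite lerD2l lerN2 hnd.
Qed.

Lemma average_eq0 x t : 0 < t <= 1 -> N + 1 <= `|x| -> average x t = 0.
Proof.
move=> /andP[t0 t1] Nx; have [c /andP[xc cx] ->] := average_mean x t0.
apply: kN; have xcx : `|c - x| <= t by rewrite ler_norml; apply/andP; split; lra.
have := ler_normD c (x - c); rewrite addrC subrK distrC; lra.
Qed.

Lemma is_derive_average_l (x t : R) : 0 < t ->
  is_derive x 1 (fun x => average x t) ((k (x + t) - k x) / t).
Proof.
move=> t0.
have d1 := is_derive_addf (is_derive_id x 1) (is_derive_cst t x 1).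
have d2 := is_derive_compf (g := fun x => x + t) (x := x) (dK1 _) d1.
have := is_derive_mulf (is_derive_subf d2 (dK1 x)) (is_derive_cst t^-1 x 1).
by move=> /is_derive_eq; apply; rewrite mulr0 !addr0 mulr1.
Qed.

(** The quotient rule leaves k(x + d) minus the average, again an oscillation of k over [x, x + d];
    so the vertical derivative obeys the same bound as the horizontal one. *)
Lemma is_derive_average_r (d : R -> R) (x y d' : R) : 0 < d y ->
  is_derive y 1 d d' -> is_derive y 1 (fun y => average x (d y))
    ((k (x + d y) - average x (d y)) / d y * d').
Proof.
move=> d0 dd.
have d1 := is_derive_addf (is_derive_cst x y 1) dd.
have d2 := is_derive_compf (g := fun y => x + d y) (x := y) (dK1 _) d1.
have := is_derive_divf (lt0r_neq0 d0) (is_derive_subf d2 (is_derive_cst (K1 x) y 1)) dd.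
move=> /is_derive_eq; apply; rewrite /average/cst/=; field.
by rewrite gt_eqF.
Qed.

End average.

Section witness.
Variable R : realType.
Variables (C F : set R) (a b : R) (k K1 : R -> R).
Hypotheses (cC : closed C) (cF : closed F) (Fa : F a) (Fb : F b).
Hypothesis ck : continuous k.
Hypothesis kC : forall x y, x <= y -> (forall t, x <= t <= y -> ~ C t) -> k x = k y.
Hypothesis dK1 : forall x : R, is_derive x 1 K1 (k x).
Notation G := (gap_set F a b).
Notation d := (gap_dist F).
Notation A := (average K1).
Implicit Types (z : R * R) (x y t : R).

(* The profile [k], mollified in the first variable at the scale of the distance
   of the second one to [F]. *)
Definition witness (z : R * R) :=
  hump a b z.2 * (if `[< G z.2 >] then A z.1 (d z.2) else k z.1).

Let near_snd (P : R -> Prop) (z : R * R) : (\forall y \near z.2, P y) ->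
  \forall z' \near z, P z'.2.
Proof. by move=> Py; exact: (@cvg_snd _ _ (nbhs z.1) (nbhs z.2) _ P Py). Qed.

Let d_gt0 y : G y -> 0 < d y.
Proof. exact: gap_dist_gt0. Qed.

Lemma witness_gap z : G z.2 -> witness z = hump a b z.2 * A z.1 (d z.2).
Proof. by move=> Gz; rewrite /witness asboolT. Qed.

Lemma witness_F z : F z.2 -> witness z = hump a b z.2 * k z.1.
Proof. by move=> Fz; rewrite /witness asboolF// => -[]. Qed.

Lemma witness_near_gap z : G z.2 -> \forall z' \near z,
  G z'.2 /\ witness z' = hump a b z'.2 * A z'.1 (d z'.2).
Proof.
move=> Gz; have : \forall y \near z.2, G y.
  by apply: open_nbhs_nbhs; split => //; exact: open_gap_set.
by move=> /near_snd; apply: filterS => z' Gz'; split => //; exact: witness_gap.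
Qed.

Lemma witness_out z : ~ (a <= z.2 <= b) -> witness z = 0.
Proof.
move=> zab; rewrite /witness hump_eq0 ?mul0r//.
by apply/negP => /andP[? ?]; apply: zab; rewrite !ltW.
Qed.

Lemma witness_near_out z : ~ (a <= z.2 <= b) ->
  \forall z' \near z, witness z' = 0.
Proof.
move=> zab; have : \forall y \near z.2, ~ (a <= y <= b).
  have : nbhs z.2 (~` `[a, b]).
    apply: open_nbhs_nbhs; split; last by rewrite /= in_itv.
    by apply: closed_openC; exact: itv_closed.
  by apply: filterS => y; rewrite /= in_itv.
by move=> /near_snd; apply: filterS => z'; exact: witness_out.
Qed.

(** k is constant on a ball of radius e around z.1. Within e / 2 of z, the point x moves by less
    than e / 2 and the window has length d(y) <= |y - z.2| < e / 2, so the average only sees this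
    constant. *)
Lemma witness_near_F z : F z.2 -> ~ C z.1 ->
  \forall z' \near z, witness z' = hump a b z'.2 * k z.1.
Proof.
case: z => x0 y0 /= Fy nCx.
have /nbhs_ballP[e /= e0 eC] : nbhs x0 (~` C).
  by apply: open_nbhs_nbhs; split => //; exact: closed_openC.
have k_cst x : `|x0 - x| < e -> k x = k x0.
  rewrite ltr_norml => /andP[? ?].
  have [xx|xx] := leP x x0.
    apply: kC => // t /andP[? ?]; apply: eC; rewrite /ball/= ltr_norml.
    by apply/andP; split; lra.
  apply/esym; apply: kC; first exact: ltW.
  move=> t /andP[? ?]; apply: eC; rewrite /ball/= ltr_norml.
  by apply/andP; split; lra.
apply/nbhs_ballP; exists (e / 2) => /=; first by rewrite divr_gt0.
move=> [x y] [/=]; rewrite /ball/= => xx yy; rewrite /witness/=; congr (_ * _).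
case: asboolP => [Gy|_]; last by apply: k_cst; lra.
have [c /andP[xc cx] ->] := average_mean dK1 x (d_gt0 Gy).
apply: k_cst; have := gap_dist_le cF Fa Fb Gy Fy.
rewrite distrC => dy; move: xx; rewrite !ltr_norml => /andP[? ?].
by apply/andP; split; lra.
Qed.

Definition witness_dx z := hump a b z.2 *
  ((k (z.1 + d z.2) - k z.1) / d z.2).

Definition witness_dy z := 'D_1 (hump a b) z.2 * A z.1 (d z.2) +
  hump a b z.2 * ((k (z.1 + d z.2) - A z.1 (d z.2)) / d z.2 * gap_dist' F z.2).

Let is_derive_hump y : is_derive y 1 (hump a b) ('D_1 (hump a b) y).
Proof. by have [_ [db _]] := @smooth_hump R a b 1%N; exact: DeriveDef. Qed.

Lemma is_derive_witness_dx z : G z.2 -> is_derive z e1 witness (witness_dx z).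
Proof.
case: z => x y Gy; apply: is_derive_e1.
have := is_derive_mulf (is_derive_cst (hump a b y) x 1)
  (is_derive_average_l dK1 x (d_gt0 Gy)).
rewrite mul0r add0r => h1.
by apply: near_eq_is_derive h1; near=> t; rewrite witness_gap.
Unshelve. all: by end_near. Qed.

Lemma is_derive_witness_dy z : G z.2 -> is_derive z e2 witness (witness_dy z).
Proof.
case: z => x y Gy; apply: is_derive_e2.
have h1 := is_derive_mulf (is_derive_hump y)
  (is_derive_average_r dK1 x (d_gt0 Gy) (is_derive_gap_dist cF Fa Fb Gy)).
apply: near_eq_is_derive h1.
have : \forall y' \near y, G y'.
  by apply: open_nbhs_nbhs; split => //; exact: open_gap_set.
by apply: filterS => t Gt; rewrite witness_gap.
Qed.

Section continuity.
Variable z : R * R.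
Hypothesis Gz : G z.2.

Let c1 : {for z, continuous (fun z => z.1)} := @cvg_fst _ _ _ _ _.
Let c2 : {for z, continuous (fun z => z.2)} := @cvg_snd _ _ _ _ _.

Let cd : {for z, continuous (fun z => d z.2)}.
Proof.
apply: (@continuous_comp _ _ _ snd d) => //.
exact: is_derive_continuous (is_derive_gap_dist cF Fa Fb Gz).
Qed.

Let cxd : {for z, continuous (fun z => z.1 + d z.2)}.
Proof. by apply: cvgD. Qed.

Let ccomp (f : R -> R) (g : R * R -> R) : continuous f ->
  {for z, continuous g} -> {for z, continuous (fun z => f (g z))}.
Proof. by move=> cf cg; exact: (continuous_comp cg (cf (g z))). Qed.

Let cinv : {for z, continuous (fun z => (d z.2)^-1)}.
Proof. by apply: cvgV => //; rewrite gt_eqF// d_gt0. Qed.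

Let cK1 : continuous K1.
Proof. by move=> x; exact: is_derive_continuous (dK1 x). Qed.

Let cA : {for z, continuous (fun z => A z.1 (d z.2))}.
Proof. by apply: cvgM => //; apply: cvgB; exact: ccomp. Qed.

Let cb : continuous (hump a b).
Proof. by move=> y; exact: is_derive_continuous (is_derive_hump y). Qed.

Lemma continuous_witness_gap : {for z, continuous witness}.
Proof.
apply: (@near_eq_continuous_at _ _ _ (fun z => hump a b z.2 * A z.1 (d z.2))).
  by apply: filterS (witness_near_gap Gz) => z' [].
by apply: cvgM => //; exact: ccomp.
Qed.

Lemma continuous_witness_dx : {for z, continuous witness_dx}.
Proof.
apply: cvgM; first exact: ccomp.
by apply: cvgM => //; apply: cvgB; exact: ccomp.
Qed.

Lemma continuous_witness_dy : {for z, continuous witness_dy}.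
Proof.
have cb' : continuous (fun y => 'D_1 (hump a b) y).
  by have [_ [_ []]] := @smooth_hump R a b 1%N.
apply: cvgD.
  by apply: cvgM => //; exact: (@ccomp (fun y => 'D_1 (hump a b) y)).
apply: cvgM; first exact: ccomp.
apply: cvgM.
  by apply: cvgM => //; apply: cvgB => //; exact: ccomp.
apply: (@continuous_comp _ _ _ snd (gap_dist' F)) => //.
exact: (continuous_gap_dist' cF Fa Fb Gz).
Qed.

End continuity.

Lemma C1_at_hump (r : R) e z : e = e1 \/ e = e2 ->
  C1_at e (fun z => hump a b z.2 * r) z.
Proof.
move=> e12.
have [ct [dt1 dt2 [ct1 _] [ct2 _]]] : Ck 1 (tensor (cst r) (hump a b)).
  by apply: Ck_tensor; [exact: smooth_cst|exact: smooth_hump].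
rewrite (_ : (fun z => _) = tensor (cst r) (hump a b)); last first.
  by apply/funext => z'; rewrite mulrC.
by case: e12 => ->; split; [exact: ct|near=> z'; exact: dt1|exact: ct1|
                      exact: ct|near=> z'; exact: dt2|exact: ct2].
Unshelve. all: by end_near. Qed.

Lemma off_F_cases y : ~ F y -> G y \/ ~ (a <= y <= b).
Proof.
move=> nFy; have [/andP[ay yb]|yab] := pselect (a <= y <= b); [left|by right].
split => //=; rewrite in_itv/= !lt_neqAle ay yb !andbT.
by apply/andP; split; apply: contra_notN nFy => /eqP; [move=> <-|move=> ->].
Qed.

(** The ends a and b belong to F, so three local formulas suffice: bump times a constant near F, the
    average in a gap, and 0 outside [a, b]. *)
Lemma C1_at_witness e z : e = e1 \/ e = e2 -> (~` (C `*` F)) z ->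
  C1_at e witness z.
Proof.
move=> e12 nCF; have [Fz|/off_F_cases[Gz|zab]] := pselect (F z.2).
- have nC : ~ C z.1 by move=> Cz; apply: nCF.
  exact: near_eq_C1_at (witness_near_F Fz nC) (C1_at_hump _ _ e12).
- have near_G := witness_near_gap Gz.
  case: e12 => ->.
    apply: is_derive_C1_at (continuous_witness_gap Gz) _ (continuous_witness_dx Gz).
    by apply: filterS near_G => z' [Gz' _]; exact: is_derive_witness_dx.
  apply: is_derive_C1_at (continuous_witness_gap Gz) _ (continuous_witness_dy Gz).
  by apply: filterS near_G => z' [Gz' _]; exact: is_derive_witness_dy.
- apply: near_eq_C1_at (witness_near_out zab) _.
  exact: (@C1_at_cst _ _ 0).
Qed.

End witness.

(** * The energy of the profile at a given scale *)

Section profile_energy.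
Variable R : realType.
Notation mu := (@lebesgue_measure R).
Variables (h H : R -> R) (K M s p : R).
Hypotheses (K0 : 0 < K) (hnd : {homo h : x y / x <= y}).
Hypotheses (hM : forall x, 0 <= h x <= M) (ch : continuous h).
Hypothesis hK : forall x y, x <= y -> h y - h x <= K * (y - x) `^ s.
Hypothesis dH : forall x : R, is_derive x 1 H (h x).
Hypothesis p1 : 1 <= p.

(** The integral telescopes to the difference of the integrals of h over two windows of length t, at
    L and at -L. Each is t times a value of h in [0, M], so the bound does not depend on L. *)
Lemma integral_increment_le (L t : R) : 0 < L -> 0 < t ->
  (\int[mu]_(x in `[(- L)%R, L%R]) (h (x + t) - h x)%:E <= (M * t)%:E)%E.
Proof.
move=> L0 t0.
have cadd : continuous (fun x : R => x + t).
  by move=> x; apply: cvgD; [exact: cvg_id|exact: cvg_cst].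
have ci : continuous (fun x => h (x + t) - h x).
  move=> x; apply: cvgB; last exact: ch.
  by apply: (@continuous_comp _ _ _ (fun x => x + t) h); [exact: cadd|exact: ch].
have dF (x : R) : is_derive x 1 (fun x => H (x + t) - H x) (h (x + t) - h x).
  have d1 := is_derive_addf (is_derive_id x 1) (is_derive_cst t x 1).
  have := is_derive_subf (is_derive_compf (g := fun x => x + t) (x := x) (dH _) d1) (dH x).
  by move=> /is_derive_eq; apply; rewrite addr0 mulr1.
have cF (x : R) := is_derive_continuous (dF x).
rewrite (@continuous_FTC2 _ _ (fun x => H (x + t) - H x)).
- have [c1 _ ->] := mean_value L t0 dH; have [c2 _ ->] := mean_value (- L) t0 dH.
  rewrite -EFinB lee_fin; have /andP[? ?] := hM c1; have /andP[? ?] := hM c2.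
  by rewrite -mulrBl ler_pM2r//; lra.
- by lra.
- exact: continuous_subspaceT.
- split.
  + by move=> x _; case: (dF x).
  + by apply: cvg_at_right_filter; exact: cF.
  + by apply: cvg_at_left_filter; exact: cF.
- by move=> x _; rewrite derive1E; case: (dF x).
Qed.

(** Of the p powers of the increment, p - 1 are bounded by K t^s and the last one is integrated,
    giving M t. With the factor t^(-p) the exponent is s (p - 1) - p + 1 = - (1 - s)(p - 1). *)
Lemma profile_energy_le (L t : R) : 0 < L -> 0 < t ->
  (\int[mu]_(x in `[(- L)%R, L%R]) (((h (x + t) - h x) / t) `^ p)%:E <=
   (K `^ (p - 1) * M * t `^ (- ((1 - s) * (p - 1))))%:E)%E.
Proof.
move=> L0 t0; have p0 : 0 <= p - 1 by rewrite subr_ge0.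
have cadd : continuous (fun x : R => x + t).
  by move=> x; apply: cvgD; [exact: cvg_id|exact: cvg_cst].
have ci : continuous (fun x => h (x + t) - h x).
  move=> x; apply: cvgB; last exact: ch.
  by apply: (@continuous_comp _ _ _ (fun x => x + t) h); [exact: cadd|exact: ch].
have mi := continuous_measurable_fun ci.
pose c := (K * t `^ s) `^ (p - 1) * t `^ (- p).
have c0 : 0 <= c by rewrite mulr_ge0// powR_ge0.
have i0 x : 0 <= h (x + t) - h x.
  by rewrite subr_ge0 hnd// lerDl ltW.
apply: (@le_trans _ _ (\int[mu]_(x in `[(- L)%R, L%R]) (c%:E * (h (x + t) - h x)%:E))%E).
  apply: ge0_le_integral => //.
  - by move=> x _; rewrite lee_fin powR_ge0.
  - apply/measurable_EFinP; apply: measurable_funTS.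
    apply: (measurableT_comp (measurable_powR _)) => //.
    by apply: measurable_funM.
  - by apply/measurable_EFinP; apply: measurable_funTS; exact: measurable_funM.
  - move=> x _; rewrite -EFinM lee_fin.
    rewrite -[p in leLHS](subrK 1 p) powRD; last first.
      by rewrite subrK gt_eqF// (lt_le_trans ltr01).
    rewrite powRr1 ?divr_ge0 ?(ltW t0)// powRM ?invr_ge0 ?(ltW t0)//.
    have tp : t^-1 `^ (p - 1) * t^-1 = t `^ (- p).
      rewrite -{2}[t^-1]powRr1 ?invr_ge0 ?(ltW t0)// -powRD; last first.
        by rewrite invr_eq0 (gt_eqF t0) implybT.
      by rewrite subrK -powR_inv1 ?(ltW t0)// -powRrM mulN1r.
    rewrite (_ : _ * (_ / t) = (h (x + t) - h x) `^ (p - 1) *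
      (t^-1 `^ (p - 1) * t^-1) * (h (x + t) - h x)); last by ring.
    rewrite tp /c ler_wpM2r ?i0// ler_wpM2r ?powR_ge0//.
    apply: ge0_ler_powR; rewrite ?nnegrE ?mulr_ge0 ?powR_ge0 ?(ltW K0) ?i0//.
    have := hK (x := x) (y := x + t).
    by rewrite lerDl (ltW t0) => /(_ isT); rewrite [x + t]addrC addrK.
rewrite ge0_integralZl//; last 2 first.
- by apply/measurable_EFinP; exact: measurable_funTS.
- by move=> x _; rewrite lee_fin.
apply: (@le_trans _ _ (c%:E * (M * t)%:E)%E).
  by rewrite lee_wpmul2l ?lee_fin//; exact: integral_increment_le.
rewrite -EFinM lee_fin /c powRM ?powR_ge0 ?(ltW K0)// -powRrM.
rewrite (_ : _ * (M * t) = K `^ (p - 1) * M *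
  (t `^ (s * (p - 1)) * t `^ (- p) * t `^ 1)); last by rewrite powRr1 ?(ltW t0)//; ring.
rewrite -!powRD ?(gt_eqF t0) ?implybT//.
by rewrite (_ : s * (p - 1) + - p + 1 = - ((1 - s) * (p - 1)))//; ring.
Qed.

End profile_energy.

Lemma inLp_integral (R : realType) (p : R) (Omega : set (R * R)) (f : R * R -> R) :
  0 < p -> measurable (Omega : set (measurableTypeR R * measurableTypeR R)) ->
  measurable_fun (Omega : set (measurableTypeR R * measurableTypeR R)) f ->
  (\int[lebesgue2]_(z in Omega) (`|f z| `^ p)%:E < +oo)%E ->
  inLp p%:E Omega f.
Proof.
move=> p0 mO mf fi; rewrite /inLp inE; apply/andP; split; rewrite inE/=.
  exact: (measurable_restrictT _ mO).1.
rewrite /finite_norm unlock; apply: poweR_lty; apply: le_lt_trans fi.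
rewrite [leRHS]integral_mkcond le_eqVlt; apply/orP; left; apply/eqP.
apply: eq_integral => z _; rewrite [RHS]patchE /= [in LHS]patchE.
by case: ifP => // _; rewrite normr0 powR0// gt_eqF.
Qed.

Lemma closed_setX (T U : topologicalType) (A : set T) (B : set U) :
  closed A -> closed B -> closed (A `*` B).
Proof.
move=> cA cB; have -> : A `*` B = fst @^-1` A `&` snd @^-1` B by [].
apply: closedI; apply: closed_comp => // z _; [exact: cvg_fst|exact: cvg_snd].
Qed.

Section sobolev_witness.
Variable R : realType.
Notation mu := (@lebesgue_measure R).
Variables (C F : set R) (a b : R) (h k H K1 : R -> R) (K M N s p : R).
Variable I : nat -> set R.
Hypotheses (cC : closed C) (cF : closed F) (Fa : F a) (Fb : F b).
Hypothesis Fab : F `<=` `[a, b].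
Hypothesis ab1 : b - a <= 1.
Hypotheses (K0 : 0 < K) (M0 : 0 < M) (N0 : 0 < N).
Hypotheses (hnd : {homo h : x y / x <= y}).
Hypotheses (hM : forall x, 0 <= h x <= M) (ch : continuous h).
Hypothesis hK : forall x y, x <= y -> h y - h x <= K * (y - x) `^ s.
Hypothesis dH : forall x : R, is_derive x 1 H (h x).
Hypotheses (kM : forall x, 0 <= k x <= M) (ck : continuous k).
Hypothesis kN : forall x, N <= `|x| -> k x = 0.
Hypothesis kh : forall x y, x <= y -> `|k y - k x| <= h y - h x.
Hypothesis kC : forall x y, x <= y -> (forall t, x <= t <= y -> ~ C t) -> k x = k y.
Hypothesis dK1 : forall x : R, is_derive x 1 K1 (k x).
Hypothesis p1 : 1 <= p.
Hypotheses (oI : forall j, open (I j)) (itvI : forall j, is_interval (I j)).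
Hypothesis IF0 : forall j t, I j t -> ~ F t.
Hypothesis coverI : gap_set F a b `<=` \bigcup_j I j.
Let beta := (1 - s) * (p - 1).
Hypothesis beta1 : beta < 1.
Hypothesis sumI : (\sum_(j <oo) mu (I j) `^ (1 - beta)%R < +oo)%E.
Implicit Types (z e : R * R) (x y t : R).
Notation G := (gap_set F a b).
Notation d := (gap_dist F).
Notation u := (witness F a b k K1).
Notation Omega := (~` (C `*` F)).

Let oOmega : open Omega. Proof. by apply: closed_openC; exact: closed_setX. Qed.

Let mOmega : measurable (Omega : set (measurableTypeR R * measurableTypeR R)).
Proof. exact: open_measurable2. Qed.

Let d_gt0 y : G y -> 0 < d y. Proof. exact: gap_dist_gt0. Qed.

Let d_le1 y : G y -> d y <= 1.
Proof. by move=> Gy; exact: le_trans (gap_dist_le_width cF Fa Fb Gy) ab1. Qed.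

(** The 1 beyond N accounts for the averaging window, of length at most 1; |a| + |b| accounts for
    the vertical support [a, b]. *)
Let L := N + 1 + `|a| + `|b|.

Let out_box z : L < `|z| -> N + 1 < `|z.1| \/ ~ (a <= z.2 <= b).
Proof.
case: z => x y; rewrite prod_normE/= lt_max => /orP[] Lxy; [left|right].
  by apply: le_lt_trans Lxy; rewrite /L; have := normr_ge0 a; have := normr_ge0 b; lra.
move=> /andP[ay yb]; move: Lxy; apply/negP; rewrite -leNgt /L.
have := ler_norm b; have := ler_norm (- a); rewrite normrN => ? ?.
have := normr_ge0 a; have := normr_ge0 b; have := N0 => ? ? ?.
by rewrite ler_norml; apply/andP; split; lra.
Qed.

Let A_le z : G z.2 -> 0 <= average K1 z.1 (d z.2) <= M.
Proof. by move=> Gz; exact: average_le (d_gt0 Gz). Qed.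

Let u_far z : N + 1 <= `|z.1| -> u z = 0.
Proof.
move=> Nz; rewrite /witness; case: asboolP => [Gz|_]; last by rewrite kN ?mulr0//; lra.
by rewrite (average_eq0 kN dK1) ?mulr0// d_gt0//= d_le1.
Qed.

Lemma witness_le z : 0 <= u z <= M.
Proof.
have b01 : 0 <= hump a b z.2 <= 1 by rewrite hump_ge0 hump_le1.
have v01 : 0 <= (if `[< G z.2 >] then average K1 z.1 (d z.2) else k z.1) <= M.
  by case: asboolP => [/A_le//|_]; exact: kM.
move: b01 v01; rewrite /witness => /andP[? ?] /andP[? ?].
by rewrite mulr_ge0//= -[leRHS]mul1r ler_pM.
Qed.

Lemma witness_outside z : L < `|z| -> u z = 0.
Proof. by move=> /out_box[/ltW/u_far//|/witness_out]. Qed.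

Let C1u e z : e = e1 \/ e = e2 -> Omega z -> C1_at e u z.
Proof. exact: C1_at_witness. Qed.

Let cu : {in Omega, continuous u}.
Proof. by move=> z /set_mem Oz; case: (C1u (or_introl erefl) Oz). Qed.

Let cdu e : e = e1 \/ e = e2 -> {in Omega, continuous (fun z => 'D_e u z)}.
Proof. by move=> e12 z /set_mem Oz; case: (C1u e12 Oz). Qed.

Lemma inLp_witness : inLp p%:E Omega u.
Proof.
have mu2 := open_continuous_measurable_fun2 oOmega cu.
have p0 : 0 < p by rewrite (lt_le_trans ltr01).
apply: inLp_integral => //.
have mup : measurable_fun (Omega : set (measurableTypeR R * measurableTypeR R))
    (fun z => `|u z| `^ p).
  apply: (measurableT_comp (measurable_powR _)).
  exact: measurableT_comp.
suff iu : lebesgue2.-integrable Omega (EFin \o (fun z => `|u z| `^ p)).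
  have := integrable_lty mOmega iu; exact.
apply: (@bounded_support_integrable _ _ _ (M `^ p) L mOmega mup) => z Oz.
  rewrite ger0_norm ?powR_ge0//; have /andP[u0 uM] := witness_le z.
  by rewrite ger0_norm//; apply: ge0_ler_powR uM; rewrite ?nnegrE// ltW.
by move=> /witness_outside ->; rewrite normr0 powR0// gt_eqF.
Qed.

Let D z := (h (z.1 + d z.2) - h z.1) / d z.2.

Let D_ge0 z : G z.2 -> 0 <= D z.
Proof.
move=> Gz; have d0 := d_gt0 Gz.
by rewrite divr_ge0 ?subr_ge0 ?hnd ?lerDl// ltW.
Qed.

Lemma derive_witness_outside e z : L < `|z| -> 'D_e u z = 0.
Proof.
move=> Lz; rewrite (@near_eq_derive _ _ _ _ (cst 0)) ?derive_cst//.
by apply: filterS (near_norm_gt Lz) => z' /witness_outside.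
Qed.

(** The constant Q comes from differentiating the bump, and [D] from the oscillation of k over the
    window, which that of h dominates. Only the first part survives outside the gaps. *)
Lemma derive_witness_le : exists2 Q : R, 0 <= Q & forall e z,
  e = e1 \/ e = e2 -> Omega z ->
  `|'D_e u z| <= Q + (if `[< G z.2 >] then D z else 0).
Proof.
have cb' : continuous (fun y => 'D_1 (hump a b) y).
  by have [_ [_ []]] := @smooth_hump R a b 1%N.
have [B B0 Bb] : exists2 B, 0 <= B & forall y, a <= y <= b ->
    `|'D_1 (hump a b) y| <= B.
  have /compact_bounded[B [_ /(_ (B + 1) ltac:(lra)) hB]] :
      compact ((fun y => 'D_1 (hump a b) y) @` `[a, b]).
    apply: continuous_compact; last exact: segment_compact.
    exact: continuous_subspaceT.
  have hB' y : a <= y <= b -> `|'D_1 (hump a b) y| <= B + 1.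
    by move=> yab; apply: hB; exists y; rewrite //= in_itv.
  have ab : a <= a <= b by have := Fab Fb; rewrite lexx /= in_itv/= => /andP[].
  by exists (B + 1); first exact: le_trans (hB' _ ab).
have BM0 : 0 <= B * M by rewrite mulr_ge0// ltW.
have b1 y : 0 <= hump a b y <= 1 by rewrite hump_ge0 hump_le1.
exists (B * M) => // e z e12 Oz.
have [Gz|nGz] := asboolP (G z.2).
  have [Gz' _] := Gz; move: Gz'; rewrite /= in_itv/= => /andP[az zb].
  have zab : a <= z.2 <= b by rewrite !ltW.
  have d0 := d_gt0 Gz; have /andP[A0 AM] := A_le Gz.
  have /andP[hb0 hb1] := b1 z.2.
  have leD r : `|r| <= h (z.1 + d z.2) - h z.1 -> `|r / d z.2| <= D z.
    move=> rl; rewrite normrM [`|_^-1|]ger0_norm ?invr_ge0 ?(ltW d0)//.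
    by rewrite ler_wpM2r// invr_ge0 ltW.
  case: e12 => ->.
    have [_ ->] := is_derive_witness_dx cF Fa Fb dK1 Gz.
    rewrite /witness_dx normrM ger0_norm//.
    apply: (@le_trans _ _ (D z)); last by rewrite lerDr.
    rewrite -[leRHS]mul1r ler_pM//; apply: leD; apply: kh.
    by rewrite lerDl ltW.
  have [_ ->] := is_derive_witness_dy cF Fa Fb dK1 Gz.
  apply: le_trans (ler_normD _ _) _; apply: lerD.
    by rewrite normrM ler_pM// ?Bb// ger0_norm.
  have g1 := gap_dist'_le1 cF Fa Fb Gz.
  move: (gap_dist' F z.2) g1 => g g1.
  rewrite normrM ger0_norm// normrM.
  rewrite -[leRHS]mul1r; apply: ler_pM => //.
  rewrite -[leRHS]mulr1; apply: ler_pM => //.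
  by apply: leD; exact: (average_osc hnd kh dK1).
rewrite addr0; have [Fz|/(off_F_cases Fa Fb)[//|zab]] := pselect (F z.2); last first.
  rewrite (@near_eq_derive _ _ _ _ (cst 0)) ?derive_cst ?normr0//.
  exact: witness_near_out zab.
have nC : ~ C z.1 by move=> Cz; apply: Oz.
have zab : a <= z.2 <= b by have := Fab Fz; rewrite /= in_itv.
have /andP[k0 kM1] := kM z.1.
rewrite (near_eq_derive _ (witness_near_F cC cF Fa Fb kC dK1 Fz nC)).
rewrite (_ : (fun z' => hump a b z'.2 * k z.1) = tensor (cst (k z.1)) (hump a b)); last first.
  by apply/funext => z'; rewrite /tensor mulrC.
have [_ [db _]] := @smooth_hump R a b 1%N.
case: z {Oz Fz nC nGz} zab k0 kM1 => x y /= zab k0 kM1; case: e12 => ->.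
  by rewrite derive_tensor_e1 ?derive_cst ?mul0r ?normr0//; exact: derivable_cst.
by rewrite derive_tensor_e2// normrM mulrC ler_pM// ?Bb// /cst ger0_norm.
Qed.

Let box : set (measurableTypeR R * measurableTypeR R) :=
  `[- L, L]%classic `*` G.

Let mbox : measurable box.
Proof.
apply: measurableX; first exact: measurable_itv.
by apply: open_measurable; exact: open_gap_set.
Qed.

Let cD z : G z.2 -> {for z, continuous D}.
Proof.
move=> Gz.
have c1 : {for z, continuous (fun z => z.1)} by exact: cvg_fst.
have cd : {for z, continuous (fun z => d z.2)}.
  apply: (@continuous_comp _ _ _ snd d); first exact: cvg_snd.
  exact: is_derive_continuous (is_derive_gap_dist cF Fa Fb Gz).
have chz (g : R * R -> R) : {for z, continuous g} ->
    {for z, continuous (fun z => h (g z))}.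
  by move=> cg; exact: (continuous_comp cg (@ch (g z))).
apply: cvgM; last by apply: cvgV => //; rewrite gt_eqF// d_gt0.
by apply: cvgB; [apply: chz; exact: cvgD|exact: chz].
Qed.

Let mD : measurable_fun setT ((fun z => D z `^ p) \_ box).
Proof.
apply: (measurable_restrictT _ mbox).1.
have oG2 : open (setT `*` G : set (R * R)).
  rewrite (_ : setT `*` G = snd @^-1` G).
    by apply: open_comp => [z _|]; [exact: cvg_snd|exact: open_gap_set].
  by apply/seteqP; split => [z []//|z].
apply: (measurable_funS (E := setT `*` G)).
- exact: open_measurable2.
- by move=> z [_ ?]; split.
apply: (measurableT_comp (measurable_powR _)).
apply: open_continuous_measurable_fun2 => // z /set_mem [_ Gz].
exact: cD.
Qed.

(** The integration in x is done first: by [profile_energy_le] it leaves a constant times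
    d(y)^(-beta), which the gap estimate integrates in y. *)
Let intD : (\int[lebesgue2]_z (((fun z => D z `^ p) \_ box) z)%:E < +oo)%E.
Proof.
rewrite /lebesgue2 fubini_tonelli2; last 2 first.
- by apply/measurable_EFinP.
- move=> z; rewrite lee_fin patchE; case: ifP => // _; exact: powR_ge0.
pose c := K `^ (p - 1) * M.
have c0 : 0 <= c by rewrite mulr_ge0 ?powR_ge0// ltW.
have mG : measurable G by apply: open_measurable; exact: open_gap_set.
have mdb : measurable_fun setT
    ((fun y => d y `^ (- beta)) \_ G : measurableTypeR R -> R).
  apply: (measurable_restrictT _ mG).1.
  apply: (measurableT_comp (measurable_powR _)).
  apply: open_continuous_measurable_fun; first exact: open_gap_set.
  by move=> y /set_mem Gy; exact: is_derive_continuous (is_derive_gap_dist cF Fa Fb Gy).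
apply: (@le_lt_trans _ _
    (\int[mu]_y (c%:E * (((fun y => d y `^ (- beta)) \_ G) y)%:E))%E).
  apply: ge0_le_integral => //.
  - move=> y _; apply: integral_ge0 => x _.
    by rewrite lee_fin patchE; case: ifP => // _; exact: powR_ge0.
  - apply: measurable_fun_fubini_tonelli_G; first exact/measurable_EFinP.
    by move=> z; rewrite lee_fin patchE; case: ifP => // _; exact: powR_ge0.
  - by apply: measurable_funeM; exact/measurable_EFinP.
  move=> y _; rewrite /fubini_G patchE; case: ifPn => [/set_mem Gy|/negP nGy].
    rewrite (_ : integral _ _ _ =
      \int[mu]_(x in `[(- L)%R, L%R]) (((h (x + d y) - h x) / d y) `^ p)%:E)%E.
      rewrite -EFinM; apply: (profile_energy_le K0 hnd hM ch hK dH p1 _ (d_gt0 Gy)).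
      rewrite /L; have := normr_ge0 a; have := normr_ge0 b; have := N0; lra.
    rewrite [RHS]integral_mkcond; apply: eq_integral => x _.
    rewrite !patchE; have [xL|xL] := boolP (x \in `[(- L)%R, L]%classic).
      by rewrite mem_set//; split => //; exact/set_mem.
    rewrite ifN// notin_setE => -[/= xL' _].
    by move: xL; rewrite notin_setE; exact.
  rewrite mule0 integral0_eq// => x _; rewrite patchE ifN//.
  by rewrite notin_setE => -[_ /= Gy]; apply: nGy; exact/mem_set.
rewrite ge0_integralZl//; last 2 first.
- exact/measurable_EFinP.
- move=> y _; rewrite lee_fin patchE; case: ifP => // _; exact: powR_ge0.
apply: lte_mul_pinfty; [by rewrite lee_fin|by []|].
have := gap_integral_lty cF Fa Fb ab1 oI itvI IF0 coverI beta1 sumI.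
rewrite [X in (X < _)%E -> _]integral_mkcond.
apply: le_lt_trans; rewrite le_eqVlt; apply/orP; left; apply/eqP.
by apply: eq_integral => y _; rewrite !patchE; case: ifP.
Qed.

Lemma inLp_derive_witness e : e = e1 \/ e = e2 ->
  inLp p%:E Omega (fun z => 'D_e u z).
Proof.
move=> e12; have mdu := open_continuous_measurable_fun2 oOmega (cdu e12).
have p0 : 0 < p by rewrite (lt_le_trans ltr01).
have [Q Q0 duQ] := derive_witness_le.
apply: inLp_integral => //.
pose box2 : set (measurableTypeR R * measurableTypeR R) :=
  `[- L, L]%classic `*` `[- L, L]%classic.
have mbox2 : measurable box2 by apply: measurableX; exact: measurable_itv.
have in_box2 z : `|z| <= L -> box2 z.
  case: z => x y; rewrite prod_normE/= ge_max !ler_norml => /andP[? ?].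
  by split; rewrite /= in_itv.
pose S := (fun z => D z `^ p) \_ box.
have S0 z : 0 <= S z by rewrite /S patchE; case: ifP => // _; exact: powR_ge0.
(* Comparing Q with D gives (Q + D)^p <= (2 Q)^p + (2 D)^p. The derivative vanishes off [box2],
   whose indicator makes the constant term integrable. *)
apply: (@le_lt_trans _ _ (\int[lebesgue2]_z
    ((((2 * Q) `^ p)%:E * (\1_box2 z)%:E) + (2 `^ p)%:E * (S z)%:E))%E).
  rewrite integral_mkcond; apply: ge0_le_integral => //.
  - by move=> z _; rewrite patchE; case: ifP => // _; rewrite lee_fin powR_ge0.
  - apply: (measurable_restrictT _ mOmega).1; apply/measurable_EFinP.
    by apply: (measurableT_comp (measurable_powR _)); exact: measurableT_comp.
  - apply: emeasurable_funD; apply: measurable_funeM; apply/measurable_EFinP.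
      exact: measurable_indic.
    exact: mD.
  move=> z _.
  have rhs0 : 0 <= (2 * Q) `^ p * \1_box2 z + 2 `^ p * S z.
    by rewrite addr_ge0// mulr_ge0// ?powR_ge0.
  rewrite patchE -!EFinM -EFinD; case: ifPn => [/set_mem Oz|_]; last by rewrite lee_fin.
  rewrite lee_fin; have [zL|Lz] := leP `|z| L; last first.
    by rewrite derive_witness_outside// normr0 powR0 ?gt_eqF.
  rewrite indicE mem_set ?mulr1; last exact: in_box2.
  have := duQ e z e12 Oz; case: asboolP => [Gz|nGz] dQ.
    have Sz : S z = D z `^ p.
      rewrite /S patchE mem_set//; split => //=.
      have [+ _] := in_box2 _ zL; exact.
    rewrite Sz -powRM ?D_ge0//.
    have D0 : 0 <= 2 * D z by apply: mulr_ge0 => //; exact: D_ge0.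
    have [QD|DQ] := leP Q (D z).
      apply: (@le_trans _ _ ((2 * D z) `^ p)); last by rewrite lerDr powR_ge0.
      apply: ge0_ler_powR; rewrite ?nnegrE ?(ltW p0)//.
      by apply: le_trans dQ _; lra.
    apply: (@le_trans _ _ ((2 * Q) `^ p)); last by rewrite lerDl powR_ge0.
    apply: ge0_ler_powR; rewrite ?nnegrE ?(ltW p0) ?mulr_ge0//.
    by apply: le_trans dQ _; lra.
  apply: (@le_trans _ _ ((2 * Q) `^ p)); last by rewrite lerDl mulr_ge0 ?powR_ge0.
  apply: ge0_ler_powR; rewrite ?nnegrE ?(ltW p0) ?mulr_ge0//.
  by apply: le_trans dQ _; lra.
rewrite ge0_integralD//; last 4 first.
- by move=> z _; rewrite -EFinM lee_fin mulr_ge0// powR_ge0.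
- by apply: measurable_funeM; apply/measurable_EFinP.
- by move=> z _; rewrite -EFinM lee_fin mulr_ge0// powR_ge0.
- by apply: measurable_funeM; apply/measurable_EFinP; exact: mD.
rewrite !ge0_integralZl//; last 4 first.
- by apply/measurable_EFinP; exact: mD.
- by move=> z _; rewrite lee_fin.
- by apply/measurable_EFinP.
- by rewrite lee_fin powR_ge0.
apply: lte_add_pinfty; apply: lte_mul_pinfty; rewrite ?lee_fin ?powR_ge0//.
rewrite integral_indic// setIT.
have fin_itv : (mu `[(- L)%R, L%R] < +oo)%E.
  by rewrite lebesgue_measure_itv/=; case: ifPn => _; rewrite ltry.
rewrite [ltLHS]product_measure1E; [|exact: measurable_itv..].
by apply: lte_mul_pinfty => //; rewrite ge0_fin_numE.
Qed.

Lemma sobolev_witness : sobolev1 p%:E Omega u.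
Proof.
split; first exact: inLp_witness.
move=> e e12; exists (fun z => 'D_e u z); first exact: inLp_derive_witness.
by move=> phi tphi; apply: weak_partial_derive => // z; exact: C1u.
Qed.

End sobolev_witness.

(** * Non-extendability *)

Lemma integral_gt0_on (R : realType) (f : R -> \bar R)
    (A : set (measurableTypeR R)) :
  measurable_fun [set: measurableTypeR R] f -> (forall x, 0 <= f x)%E ->
  measurable A -> (0 < @lebesgue_measure R A)%E -> (forall x, A x -> 0 < f x)%E ->
  (0 < \int[@lebesgue_measure R]_x f x)%E.
Proof.
move=> mf f0 mA A0 fA; rewrite lt0e integral_ge0 ?andbT//.
apply/eqP => i0.
have : (\int[@lebesgue_measure R]_x `|f x| = 0)%E.
  by rewrite -i0; apply: eq_integral => x _; rewrite gee0_abs.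
move/(ae_eq_integral_abs _ measurableT mf).1 => [Z [mZ Z0 AZ]].
have : (@lebesgue_measure R A <= @lebesgue_measure R Z)%E.
  apply: le_measure; rewrite ?inE// => x Ax; apply: AZ => /= /(_ I) fx0.
  by have := fA x Ax; rewrite fx0 ltxx.
by rewrite Z0 leNgt A0.
Qed.

Section tensor_cutoff.
Variable R : realType.
Notation mu := (@lebesgue_measure R).
Variables (p : R) (C : set R) (a c : R -> R) (chi : nat -> R -> R).
Hypotheses (p1 : 1 <= p) (C0 : mu C = 0) (cC : closed C).
Hypotheses (ca : continuous a) (cc : continuous c).
Hypothesis cchi : forall n, continuous (chi n).
Hypotheses (a1 : forall x, `|a x| <= 1) (c1 : forall x, `|c x| <= 1).
Hypothesis chi1 : forall n x, 0 <= chi n x <= 1.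
Hypothesis chi_cvg : forall x, ~ C x -> chi n x @[n --> \oo] --> (1 : R).
Variable L : R.
Hypothesis tensor0 : forall z, L < `|z| -> tensor a c z = 0.
Variable f : R * R -> R.
Hypothesis fp : f \in Lfun (@lebesgue2 R) p%:E.

Let mf : measurable_fun [set: measurableTypeR R * measurableTypeR R] f.
Proof. by move: fp; rewrite inE => /andP[/[!inE]]. Qed.

Let mt : measurable_fun [set: measurableTypeR R * measurableTypeR R] (tensor a c).
Proof. by apply: continuous_measurable_fun2; exact: continuous_tensor. Qed.

(** Since the tensor is at most 1 in absolute value, |f t| <= |t| when |f| <= 1, and |f t| <= |f| <=
    |f|^p otherwise. This gives an integrable majorant without a conjugate exponent. *)
Let dom z := `|tensor a c z| + `|f z| `^ p.

Let dom_integrable : lebesgue2.-integrable setT (EFin \o dom).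
Proof.
rewrite /dom (_ : EFin \o _ = (EFin \o (fun z => `|tensor a c z|)) \+
  (fun z => (`|f z| `^ p)%:E)); last by apply/funext.
apply: integrableD => //; last exact: Lfun_integrable.
apply: (@continuous_support_integrable _ _ L).
  move=> z; apply: (@continuous_comp _ _ _ (tensor a c) (fun t : R => `|t|)).
    exact: continuous_tensor.
  exact: norm_continuous.
by move=> z /tensor0 ->; rewrite normr0.
Qed.

Let dom_ge z : `|f z * tensor a c z| <= dom z.
Proof.
have t1 : `|tensor a c z| <= 1.
  by rewrite /tensor normrM mulr_ile1.
rewrite normrM /dom; have [f1|f1] := leP `|f z| 1.
  by apply: (@le_trans _ _ `|tensor a c z|); [rewrite ler_piMl|rewrite lerDl powR_ge0].
apply: (@le_trans _ _ (`|f z| `^ p)); last by rewrite lerDr.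
apply: (@le_trans _ _ `|f z|); first by rewrite ler_piMr.
by rewrite -[leLHS]powRr1// ler_powR// ltW.
Qed.

Lemma Lp_tensor_integrable :
  lebesgue2.-integrable setT (EFin \o (fun z => f z * tensor a c z)).
Proof.
apply: (le_integrable measurableT _ _ dom_integrable).
  by apply/measurable_EFinP; exact: measurable_funM.
move=> z _ /=; rewrite lee_fin (le_trans (dom_ge z))// ler_norm//.
Qed.

(** Dominated convergence: pointwise convergence can fail only on C x R, which is null because C
    is. *)
Lemma Lp_tensor_cutoff_cvg :
  (\int[lebesgue2]_z (f z * tensor (fun x => a x * chi n x) c z)%:E @[n --> \oo]
   --> \int[lebesgue2]_z (f z * tensor a c z)%:E)%E.
Proof.
have mtn n : measurable_fun [set: measurableTypeR R * measurableTypeR R]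
    (tensor (fun x => a x * chi n x) c).
  apply: continuous_measurable_fun2; apply: continuous_tensor => //.
  by move=> x; apply: cvgM; [exact: ca|exact: cchi].
have [//|||||_ _] := @dominated_convergence _ _ R (@lebesgue2 R) setT measurableT
  (fun n z => (f z * tensor (fun x => a x * chi n x) c z)%:E)
  (fun z => (f z * tensor a c z)%:E) (EFin \o dom).
- by move=> n; apply/measurable_EFinP; exact: measurable_funM.
- by apply/measurable_EFinP; exact: measurable_funM.
- exists (C `*` setT); split.
  + by apply: measurableX => //; exact: closed_measurable.
  + rewrite [LHS]product_measure1E//; last exact: closed_measurable.
    by rewrite [X in (X * _)%E]C0 mul0e.
  + move=> z /= nz; split => //; apply: contrapT => nC; apply: nz => _.
    apply: cvg_EFin; first exact: nearW.
    rewrite /tensor; apply: cvgM; first exact: cvg_cst.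
    apply: cvgM; last exact: cvg_cst.
    rewrite -[X in _ --> X]mulr1; apply: cvgM; first exact: cvg_cst.
    exact: chi_cvg.
- exact: dom_integrable.
- apply: aeW => z n _ /=; rewrite lee_fin; apply: le_trans (dom_ge z).
  have /andP[? ?] := chi1 n z.1.
  rewrite /tensor !normrM ler_wpM2l// ler_wpM2r// ler_piMr//.
  by rewrite ger0_norm.
- exact.
Qed.

End tensor_cutoff.

Section no_weak_extension.
Variable R : realType.
Notation mu := (@lebesgue_measure R).
Variables (C F : set R) (a b M N p : R) (k : R -> R) (u : R * R -> R).
Hypotheses (cC : closed C) (cF : closed F) (Fab : F `<=` `[a, b]).
Hypotheses (C0 : mu C = 0) (F0 : (0 < mu F)%E).
Hypotheses (p1 : 1 <= p) (N0 : 0 < N).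
Hypotheses (k0 : forall x, 0 <= k x) (ck : continuous k).
Hypothesis kN : forall x, N <= `|x| -> k x = 0.
Hypothesis k_neq0 : exists x, k x != 0.
Notation Omega := (~` (C `*` F)).
Hypothesis C1u : forall z, Omega z -> C1_at e1 u z.
Hypothesis u_near_F : forall z, F z.2 -> ~ C z.1 ->
  \forall z' \near z, u z' = hump a b z'.2 * k z.1.
Hypothesis uF : forall z, F z.2 -> u z = hump a b z.2 * k z.1.
Hypothesis uM : forall z, `|u z| <= M.
Hypothesis du_p : inLp p%:E Omega (fun z => 'D_e1 u z).
Implicit Types (z : R * R) (x y t : R).

Let oOmega : open Omega. Proof. by apply: closed_openC; exact: closed_setX. Qed.

Let mOmega : measurable (Omega : set (measurableTypeR R * measurableTypeR R)).
Proof. exact: open_measurable2. Qed.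

(* [f] increases on the support [-N, N] of [k]. *)
Let f := hump (- N - 1) (3 * N + 1).
Let g := hump (a - 1) (b + 1).
Let phi := tensor f g.
Let L := 3 * N + 1 + `|a| + `|b| + 1.

Let L0 : 0 < L.
Proof. by have := N0; have := normr_ge0 a; have := normr_ge0 b; rewrite /L; lra. Qed.

Let f0 x : L < `|x| -> f x = 0.
Proof.
move=> Lx; apply: hump_eq0; apply/negP => /andP[? ?].
move: Lx; apply/negP; rewrite -leNgt ler_norml /L; have := N0.
by have := normr_ge0 a; have := normr_ge0 b => ? ? ?; apply/andP; split; lra.
Qed.

Let g0 y : L < `|y| -> g y = 0.
Proof.
move=> Ly; apply: hump_eq0; apply/negP => /andP[? ?].
move: Ly; apply/negP; rewrite -leNgt ler_norml /L; have := N0.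
have := ler_norm b; have := ler_norm (- a); rewrite normrN.
by have := normr_ge0 a; have := normr_ge0 b => ? ? ? ? ?; apply/andP; split; lra.
Qed.

Let phi0 z : L < `|z| -> phi z = 0.
Proof.
case: z => x y; rewrite prod_normE/= lt_max /phi /tensor/= => /orP[/f0->|/g0->].
  by rewrite mul0r.
by rewrite mulr0.
Qed.

Let tphi : test_function setT phi.
Proof.
apply: (@test_function_tensor R setT f g setT L) => //.
- exact: smooth_hump.
- exact: smooth_hump.
Qed.

Let df x : is_derive x 1 f ('D_1 f x).
Proof. by have [_ [d1 _]] := @smooth_hump R (- N - 1) (3 * N + 1) 1%N; exact: DeriveDef. Qed.

Let cdf : continuous (fun x => 'D_1 f x).
Proof. by have [_ [_ []]] := @smooth_hump R (- N - 1) (3 * N + 1) 1%N. Qed.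

Let cf : continuous f.
Proof. by move=> x; exact: is_derive_continuous (df x). Qed.

Let cg : continuous g.
Proof. by have [] := @smooth_hump R (a - 1) (b + 1) 0%N. Qed.

Let dphi x y : 'D_e1 phi (x, y) = 'D_1 f x * g y.
Proof. by apply: derive_tensor_e1; case: (df x). Qed.

Let kappa := (\int[mu]_x (k x * 'D_1 f x)%:E)%E.

(** The midpoint of ]-N - 1, 3 N + 1[ is N, so [derive_hump_gt0] covers the whole of ]-N, N[. *)
Let kf0 x : 0 <= k x * 'D_1 f x.
Proof.
have [Nx|xN] := leP N `|x|; first by rewrite kN// mul0r.
rewrite mulr_ge0// ltW// derive_hump_gt0//.
- by move: xN; rewrite ltr_norml => /andP[? _]; lra.
- by move: xN; rewrite ltr_norml => /andP[_ ?]; lra.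
Qed.

Let ckf : continuous (fun x => k x * 'D_1 f x).
Proof. by move=> x; apply: cvgM; [exact: ck|exact: cdf]. Qed.

Let kappa_gt0 : (0 < kappa)%E.
Proof.
have [x0 kx0] := k_neq0.
have kx0' : 0 < k x0 by rewrite lt0r kx0 k0.
have : \forall x \near x0, 0 < k x.
  exact: (cvgr_gt (k x0) (@ck x0)).
move=> /nbhs_ballP[e /= e0 ek].
apply: (@integral_gt0_on _ _ (ball x0 e)) => //.
- by apply/measurable_EFinP; exact: continuous_measurable_fun.
- exact: measurable_ball.
- by rewrite lebesgue_measure_ball ?ltW// lte_fin mulrn_wgt0.
- move=> x /ek kx; rewrite lte_fin; have xN : `|x| < N.
    by rewrite ltNge; apply/negP => /kN kx0''; move: kx; rewrite kx0'' ltxx.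
  rewrite mulr_gt0// derive_hump_gt0//.
  + by move: xN; rewrite ltr_norml => /andP[? _]; lra.
  + by move: xN; rewrite ltr_norml => /andP[_ ?]; lra.
Qed.

Let w := (fun z => 'D_e1 u z) \_ Omega.
Let v := u \_ Omega.

Let wp : w \in Lfun lebesgue2 p%:E. Proof. exact: du_p. Qed.

Let f1 x : `|f x| <= 1. Proof. by rewrite ger0_norm ?hump_ge0 ?hump_le1. Qed.
Let g1 y : `|g y| <= 1. Proof. by rewrite ger0_norm ?hump_ge0 ?hump_le1. Qed.

Let int_wphi : lebesgue2.-integrable setT (EFin \o (fun z => w z * phi z)).
Proof. exact: (Lp_tensor_integrable p1 cf cg f1 g1 phi0 wp). Qed.

Let mv : measurable_fun [set: measurableTypeR R * measurableTypeR R] v.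
Proof.
apply: (measurable_restrictT _ mOmega).1.
by apply: open_continuous_measurable_fun2 => // z /set_mem /C1u[].
Qed.

Let int_vdphi :
  lebesgue2.-integrable setT (EFin \o (fun z => v z * 'D_e1 phi z)).
Proof.
have i1 : lebesgue2.-integrable setT (EFin \o (fun z => 'D_e1 phi z)).
  apply: (@continuous_support_integrable _ _ L).
    by move=> z; case: (test_function_C1 tphi z (or_introl erefl)).
  move=> z Lz; rewrite (@near_eq_derive _ _ _ _ (cst 0)) ?derive_cst//.
  by apply: filterS (near_norm_gt Lz) => z' /phi0.
rewrite (_ : EFin \o _ = ((EFin \o v) \* (EFin \o (fun z => 'D_e1 phi z)))%E).
  apply: integrableMr => //.
  exists `|M|; split; first exact: num_real.
  move=> x Mx z _; apply: ltW; apply: le_lt_trans Mx.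
  rewrite /v patchE; case: ifP => _; last by rewrite normr0.
  by rewrite (le_trans (uM z))// ler_norm.
by apply/funext => z; rewrite /= EFinM.
Qed.

(* The horizontal slices of [v D_1 phi + w phi] integrate to 0 off [F], by the
   fundamental theorem of calculus, while [w] vanishes on the slices in [F]. *)
Let slice y : (\int[mu]_x (v (x, y) * 'D_e1 phi (x, y) + w (x, y) * phi (x, y))%:E
  = (((fun y => hump a b y * g y) \_ F) y)%:E * kappa)%E.
Proof.
rewrite patchE; case: ifPn => [/set_mem Fy|/negP nFy].
  rewrite /kappa -ge0_integralZl//=; last 3 first.
  - by apply/measurable_EFinP; exact: continuous_measurable_fun.
  - by move=> x _; rewrite lee_fin.
  - by rewrite lee_fin mulr_ge0 ?hump_ge0.
  apply: ae_eq_integral => //.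
  - apply/measurable_EFinP; apply: measurable_funD.
      have := measurable_int _ int_vdphi => /measurable_EFinP m1.
      exact: (measurableT_comp m1).
    have := measurable_int _ int_wphi => /measurable_EFinP m2.
    exact: (measurableT_comp m2).
  - apply: measurable_funeM; apply/measurable_EFinP.
    exact: continuous_measurable_fun.
  (* At the points of C, v and w are 0 by restriction, so the two integrands may differ there. *)
  exists C; split => //; first exact: closed_measurable.
  move=> x /= nx; apply: contrapT => nC; apply: nx => _.
  have Oxy : Omega (x, y) by move=> [].
  rewrite /v /w !patchE mem_set// dphi uF//= (near_eq_derive _ (@u_near_F (x, y) Fy nC)).
  rewrite (_ : (fun z' => hump a b z'.2 * k x) = tensor (cst (k x)) (hump a b)).
    rewrite derive_tensor_e1 ?derive_cst ?mul0r ?addr0; last exact: derivable_cst.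
    by rewrite -EFinM; congr EFin; ring.
  by apply/funext => z'; rewrite /tensor mulrC.
rewrite mul0e.
have Oxy x : Omega (x, y) by move=> [_ Fy]; apply: nFy; exact/mem_set.
have C1 x : C1_at e1 (fun z => u z * phi z) (x, y).
  by apply: C1_atM; [exact: C1u|exact: (test_function_C1 tphi (x, y) (or_introl erefl))].
rewrite -[RHS](integral_slice_eq0 L0 C1) => [|x Lx]; last first.
  by rewrite phi0 ?mulr0// prod_normE/= lt_max Lx.
apply: eq_integral => x _; congr EFin.
rewrite /v /w !patchE mem_set// [RHS]deriveM; last 2 first.
- exact: (near_C1_at (@C1u (x, y) (Oxy x))).
- exact: (near_C1_at (test_function_C1 tphi (x, y) (or_introl erefl))).
by rewrite [X in _ + X = _]mulrC.
Qed.

Lemma no_weak_extension :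
  ~ exists2 q, inLp p%:E setT q & weak_partial setT e1 (u \_ Omega) q.
Proof.
move=> [q qp wq].
have [chi [schi chi01 chiK chi_cvg]] := smooth_cutoffs cC.
pose phin n := tensor (fun x => f x * chi n x) g.
have tphin n : test_function Omega (phin n).
  have [K [cK KC chi_K]] := chiK n.
  apply: (@test_function_tensor R Omega _ g K L) => //.
  - by apply: smoothM => //; exact: smooth_hump.
  - exact: smooth_hump.
  - by move=> z [Kz _] [Cz _]; exact: KC Cz.
  - by move=> x; rewrite mulf_eq0 negb_or => /andP[_ /chi_K].
  - by move=> x /f0 ->; rewrite mul0r.
have tphinT n : test_function setT (phin n).
  by have [? ? _] := tphin n; split.
have qp' : q \in Lfun lebesgue2 p%:E.
  by move: qp; rewrite /inLp patch_setT.
(* [phin n] is supported in [Omega], where the classical derivative is also the weak one. The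
   derivative of [chi n] cancels out of this identity, so it may blow up with n. *)
have qw n : (\int[lebesgue2]_z (q z * phin n z)%:E =
    \int[lebesgue2]_z (w z * phin n z)%:E)%E.
  apply: oppe_inj; rewrite -wq//.
  transitivity (\int[lebesgue2]_(z in Omega) (u z * 'D_e1 (phin n) z)%:E)%E.
    rewrite [RHS]integral_mkcond; apply: eq_integral => z _.
    by rewrite !patchE; case: ifP => // _; rewrite mul0r.
  rewrite (weak_partial_derive oOmega (tphin n) (or_introl erefl) C1u).
  congr (- _)%E; rewrite [LHS]integral_mkcond; apply: eq_integral => z _.
  by rewrite /w !patchE; case: ifP => // _; rewrite mul0r.
have cchi n : continuous (chi n) by have [] := schi n 0%N.
have cvg_phin r : r \in Lfun lebesgue2 p%:E ->
    (\int[lebesgue2]_z (r z * phin n z)%:E @[n --> \oo] -->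
     \int[lebesgue2]_z (r z * phi z)%:E)%E.
  move=> rp.
  exact: (Lp_tensor_cutoff_cvg p1 C0 cC cf cg cchi f1 g1 chi01 chi_cvg phi0 rp).
have qphi : (\int[lebesgue2]_z (q z * phi z)%:E =
    \int[lebesgue2]_z (w z * phi z)%:E)%E.
  have := cvg_phin _ qp'; under eq_fun do rewrite qw.
  by move=> h; exact: (cvg_unique (@ereal_hausdorff R) h (cvg_phin _ wp)).
have : (\int[lebesgue2]_z (v z * 'D_e1 phi z + w z * phi z)%:E = 0)%E.
  under eq_integral do rewrite EFinD.
  rewrite integralD// (wq phi tphi) qphi.
  by rewrite addeC subee//; exact: integrable_fin_num int_wphi.
have isum : lebesgue2.-integrable setT
    (fun z => (v z * 'D_e1 phi z + w z * phi z)%:E).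
  exact: (integrableD measurableT int_vdphi int_wphi).
rewrite -(integral21_prod_meas1 isum) /fubini_G.
under eq_integral do rewrite slice.
apply/eqP; rewrite gt_eqF//.
have humpg y : 0 <= ((fun y => hump a b y * g y) \_ F) y.
  by rewrite patchE; case: ifP => // _; rewrite mulr_ge0 ?hump_ge0.
(* [hump a b] vanishes at a and b, hence the open interval; dropping two points leaves the measure
   of F positive. *)
apply: (@integral_gt0_on _ _ (F `&` `]a, b[)).
- apply: emeasurable_funM => //; apply/measurable_EFinP.
  apply: (measurable_restrictT _ (closed_measurable cF)).1.
  apply: measurable_funTS; apply: continuous_measurable_fun => y.
  apply: cvgM; last exact: cg.
  by have [+ _] := @smooth_hump R a b 0%N; exact.
- by move=> y; rewrite mule_ge0 ?lee_fin// ltW.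
- by apply: measurableI; [exact: closed_measurable|exact: measurable_itv].
- rewrite lt0e measure_ge0 andbT; apply/eqP => A0.
  move: F0; apply/negP; rewrite -leNgt.
  have mab : measurable (F `&` `]a, b[ : set (measurableTypeR R)).
    by apply: measurableI; [exact: closed_measurable|exact: measurable_itv].
  have -> : (0 = mu (F `&` `]a, b[) + (mu [set a] + mu [set b]))%E.
    by rewrite !lebesgue_measure_set1 A0 !adde0.
  apply: (@le_trans _ _ (mu ((F `&` `]a, b[) `|` ([set a] `|` [set b])))).
    apply: le_measure; rewrite ?inE//.
    + exact: closed_measurable.
    + by apply: measurableU => //; apply: measurableU; exact: measurable_set1.
    + move=> y Fy; have := Fab Fy; rewrite /= in_itv/= => /andP[ay yb].
      have [->|ya] := eqVneq y a; first by right; left.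
      have [->|yb'] := eqVneq y b; first by right; right.
      by left; split => //=; rewrite in_itv/= !lt_neqAle ay yb eq_sym ya yb'.
  apply: le_trans (measureU2 _ _ _) _ => //.
    by apply: measurableU; exact: measurable_set1.
  by rewrite leeD2l// measureU2.
- move=> y [Fy]; rewrite /= in_itv/= => yab; rewrite mule_gt0// lte_fin.
  rewrite patchE mem_set// mulr_gt0 ?hump_gt0//.
  by have /andP[? ?] := yab; apply/andP; split; lra.
Qed.

End no_weak_extension.

Theorem theorem1p2 (R : realType) (p s : R) (C F : set R) (I : nat -> set R)
    (hp : 2 <= p) (hs : (p - 2) / (p - 1) < s)
    (hC : closed C) (hCs : (0 < hausdorff_measure s C)%E)
    (hIopen : forall j, open (I j)) (hIint : forall j, is_interval (I j))
    (hIsum : (\sum_(j <oo)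
        lebesgue_measure (I j) `^ (1 - (1 - s) * (p - 1))%R < +oo)%E)
    (hF : F = `[0, 1] `\` \bigcup_j I j)
    (hF1 : (0 < hausdorff_measure 1 F)%E) :
  ~ removable p%:E (C `*` F).
Proof.
move=> [E0 extension].
have p1 : 0 < p - 1 by lra.
have s0 : 0 < s by apply: le_lt_trans hs; rewrite divr_ge0; lra.
(* This is the hypothesis on s, multiplied by p - 1 > 0. *)
have beta1 : (1 - s) * (p - 1) < 1.
  by move: hs; rewrite ltr_pdivrMr// => ?; rewrite mulrBl mul1r; lra.
have F01 : F `<=` `[0, 1] by rewrite hF => y [].
have cF : closed F.
  rewrite hF setDE; apply: closedI; first exact: itv_closed.
  by apply: open_closedC; exact: bigcup_open.
have IF0 j t : I j t -> ~ F t by rewrite hF => Ijt [_]; apply; exists j.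
have F_gt0 := hausdorff_measure1_gt0 hF1.
have F_neq0 : F !=set0.
  by apply/set0P/eqP => F0; move: F_gt0; rewrite F0 measure0 ltxx.
have ubF : has_ubound F by exists 1 => y /F01; rewrite /= in_itv/= => /andP[].
have lbF : has_lbound F by exists 0 => y /F01; rewrite /= in_itv/= => /andP[].
(* F need not contain 0 or 1; with these endpoints every gap has both of its ends in F. *)
pose a := inf F; pose b := sup F.
have Fa : F a by exact: closed_inf.
have Fb : F b by exact: closed_sup.
have Fab : F `<=` `[a, b].
  by move=> y Fy; rewrite /= in_itv/= ge_inf// ub_le_sup.
have := F01 _ Fa; have := F01 _ Fb; rewrite /= !in_itv/=.
move=> /andP[b0 b1] /andP[a0 a1].
have ab1 : b - a <= 1 by lra.
have coverI : gap_set F a b `<=` \bigcup_j I j.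
  move=> y [/=]; rewrite in_itv/= => /andP[ay yb]; rewrite hF => nFy.
  apply: contrapT => nI; apply: nFy; split => //=.
  by rewrite in_itv/=; apply/andP; split; lra.
have C0 : @lebesgue_measure R C = 0%E.
  move: E0; rewrite [X in X = _]product_measure1E; [|exact: closed_measurable..].
  by move=> /eqP; rewrite mule_eq0 (gt_eqF F_gt0) orbF => /eqP.
have [h [k [K [M [N [[K0 M0 N0 k_neq0] [hnd hM ch hK [H dH]]
  [kM ck kN [kh kC] [K1 dK1]]]]]]]] := tent_profile s0 hCs.
have p1' : 1 <= p by lra.
pose u := witness F a b k K1.
have u_sob : sobolev1 p%:E (~` (C `*` F)) u.
  exact: (sobolev_witness hC cF Fa Fb Fab ab1 K0 M0 N0 hnd hM ch hK dH kM ck kN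
    kh kC dK1 p1' hIopen hIint IF0 coverI beta1 hIsum).
have [_ /(_ e1 (or_introl erefl)) u_ext] := extension u u_sob.
apply: (@no_weak_extension R C F a b M N p k u) u_ext => //.
- by move=> x; case/andP: (kM x).
- move=> z Oz.
  exact: (C1_at_witness hC cF Fa Fb ck kC dK1 (or_introl erefl) Oz).
- by move=> z Fz nC; exact: (witness_near_F hC cF Fa Fb kC dK1 Fz nC).
- by move=> z Fz; exact: witness_F.
- move=> z; have /andP[? ?] := witness_le cF Fa Fb kM dK1 z.
  by rewrite ger0_norm.
- exact: (inLp_derive_witness hC cF Fa Fb Fab ab1 K0 M0 N0 hnd hM ch hK dH kM
    ck kN kh kC dK1 p1' hIopen hIint IF0 coverI beta1 hIsum (or_introl erefl)).
Qed.
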